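(* Assume the standing setting described in the context (with $J=I$) and let $\boldsymbol\gamma=(\gamma^i)_{i\in I}\in\mathfrak E_\chi(\boldsymbol A,\boldsymbol a,g)$ be an extremal measure. Then $$\sum_{i\in I}\int W^i_{\boldsymbol\gamma}\,d\gamma^i=\frac12\Bigl[\|\boldsymbol\gamma\|^2_{\mathcal E^+(\boldsymbol A)}+G_\chi(\boldsymbol A,\boldsymbol a,g)\Bigr]$$ and, for every $i\in I$, $$a_i\,W^i_{\boldsymbol\gamma}(x)\ge\Bigl(\int W^i_{\boldsymbol\gamma}\,d\gamma^i\Bigr)\,g(x)\quad\text{for n.e. }x\in A_i.$$ Moreover, these two relations characterize the numbers $\int W^i_{\boldsymbol\gamma}\,d\gamma^i$, $i\in I$, uniquely: if real numbers $\eta_i$, $i\in I$, satisfy $\sum_{i\in I}\eta_i=\frac12[\|\boldsymbol\gamma\|^2_{\mathcal E^+(\boldsymbol A)}+G_\chi(\boldsymbol A,\boldsymbol a,g)]$ and $a_iW^i_{\boldsymbol\gamma}(x)\ge\eta_i g(x)$ for n.e. $x\in A_i$, for all $i\in I$, then $\eta_i=\int W^i_{\boldsymbol\gamma}\,d\gamma^i$ for all $i\in I$.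
   Context: Standing setting. $\mathrm X$ noncompact locally compact Hausdorff; $\mathfrak M$ real Radon measures, vague topology; $S(\nu)$ support. Kernel $\kappa:\mathrm X\times\mathrm X\to[0,\infty]$ lower semicontinuous, symmetric; $\kappa(\nu,\nu_1)=\int\kappa\,d(\nu\otimes\nu_1)$, $\kappa(x,\nu)=\int\kappa(x,y)d\nu(y)$; $\mathcal E$ = measures with $\kappa(\nu,\nu)$ well defined and finite. Assumed: (a) strictly positive definite ($\|\nu\|=\kappa(\nu,\nu)^{1/2}$ a norm on the pre-Hilbert space $\mathcal E$; ''strong'' refers to it); (b) consistent: every strong Cauchy net in $\mathcal E^+=\{\nu\in\mathcal E:\nu\ge0\}$ converges strongly to each of its vague cluster points; (c) $\kappa(x,y)$ finite, continuous for $x\ne y$; (d) for each $\varepsilon>0$, compact $K$ there is compact $K'$ with $\kappa(x,y)<\varepsilon$ for $x\in K,y\notin K'$; (e) generalized maximum principle with constant $h\ge1$ (for compactly supported $\nu\ge0$ with $M=\sup_{S(\nu)}\kappa(\cdot,\nu)<\infty$, $\kappa(\cdot,\nu)\le hM$ everywhere). $\mathcal E^+_E$: elements of $\mathcal E^+$ concentrated on $E$; interior capacity $C(E)=1/\inf\{\kappa(\nu,\nu):\nu\in\mathcal E^+_E,\nu(E)=1\}$; ''n.e.'' = outside a set of interior capacity zero. Condenser: disjoint countable $I^+,I^-$, $I=I^+\cup I^-$; nonempty closed $A_i$, locally finite, $A_i\cap A_j=\varnothing$ for $i\in I^+,j\in I^-$; $\alpha_i=\pm1$ on $I^\pm$;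 $A^\pm=\bigcup_{I^\pm}A_i$, $A=\bigcup A_i$; $\sup_{A^+\times A^-}\kappa<\infty$. Vector measures $\boldsymbol\mu=(\mu^i)$, $\mu^i\ge0$ concentrated on $A_i$; $R\boldsymbol\mu=\sum\alpha_i\mu^i$; $\mathcal E^+(\boldsymbol A)$ those of finite energy $\sum_{i,j}\alpha_i\alpha_j\kappa(\mu^i,\mu^j)$; $\|\boldsymbol\mu_1-\boldsymbol\mu_2\|_{\mathcal E^+(\boldsymbol A)}:=\|R\boldsymbol\mu_1-R\boldsymbol\mu_2\|$ (strong topology on $\mathcal E^+(\boldsymbol A)$); vague topology on vector measures is componentwise. External field: bounded signed $\chi\in\mathcal E$ with $S(\chi^+)\cap A^-=\varnothing$, $S(\chi^-)\cap A^+=\varnothing$; $G_\chi(\boldsymbol\mu)=\|R\boldsymbol\mu\|^2+2\kappa(\chi,R\boldsymbol\mu)$. The weighted potential of $\boldsymbol\mu\in\mathcal E^+(\boldsymbol A)$ has components $W^i_{\boldsymbol\mu}(x)=\alpha_i\kappa(x,\chi)+\sum_{j}\alpha_i\alpha_j\kappa(x,\mu^j)=\alpha_i\kappa(x,\chi+R\boldsymbol\mu)$ (finite n.e.). $g$ continuous on $A$, $g_{\inf}=\inf_Ag>0$, and for each $i$ either $g|_{A_i}$ bounded or $g^{r_i}\le\kappa(\cdot,\nu_i)$ n.e. on $A_i$ for some $r_i>1,\nu_i\in\mathcal E$. $\boldsymbol a=(a_i)$, $a_i>0$, $\sum a_i<\infty$. For $I^+\subseteq J\subseteq I$: $\mathcal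 E^+(\boldsymbol A,\boldsymbol a,g,J)=\{\boldsymbol\mu\in\mathcal E^+(\boldsymbol A):\int g\,d\mu^i=a_i\ \forall i\in J\}$, $G_\chi(\boldsymbol A,\boldsymbol a,g,J)$ = infimum of $G_\chi$ on it; $J=I$ is dropped from notation; assumed $G_\chi(\boldsymbol A,\boldsymbol a,g)<\infty$. Extremal measures: let $H:=h[\chi^+(\mathrm X)+2g_{\inf}^{-1}\sum_{i\in J}a_i]$. A net $(\boldsymbol\mu_s)$ is minimizing for the $J$-problem if each $\boldsymbol\mu_s\in\mathcal E^+(\boldsymbol A,\boldsymbol a,g,J)$ with $\sum_i\mu^i_s(\mathrm X)\le H$, and $G_\chi(\boldsymbol\mu_s)\to G_\chi(\boldsymbol A,\boldsymbol a,g,J)$. $\tilde{\boldsymbol\gamma}\in\mathcal E^+(\boldsymbol A)$ is extremal if some minimizing net converges to it both strongly and vaguely; $\mathfrak E_\chi(\boldsymbol A,\boldsymbol a,g,J)$ is the set of extremal measures. *)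

(* Defs.v *)
From HB Require Import structures.
From mathcomp Require Import all_boot all_algebra.
From mathcomp Require Import all_classical all_reals all_analysis.

Set Implicit Arguments.
Unset Strict Implicit.
Unset Printing Implicit Defensive.
Import GRing.Theory Num.Theory numFieldNormedType.Exports.

Local Open Scope classical_set_scope.
Local Open Scope ring_scope.
Local Open Scope ereal_scope.

Definition borelT (X : ptopologicalType) := g_sigma_algebraType (@open X).

(* Positive measures are represented as set functions on Borel sets. *)
Definition pmeas (R : realType) (X : ptopologicalType) :=
  set (borelT X) -> \bar R.

Section potential_theory.
Context {R : realType} {X : ptopologicalType}.
Implicit Types (mu nu p n : pmeas R X).

Definition radon mu :=
  [/\ mu set0 = 0,
      (forall B : set (borelT X), measurable B -> 0 <= mu B) &
      semi_sigma_additive mu] /\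
  [/\ (forall K : set X, compact K -> mu K < +oo),
      (forall B : set (borelT X), measurable B ->
          mu B = ereal_inf [set mu U | U in [set U : set X | open U /\ B `<=` U]]) &
      (forall U : set X, open U ->
          mu U = ereal_sup [set mu K | K in [set K : set X | compact K /\ K `<=` U]])].

Definition meas_eq mu nu := forall B : set (borelT X), measurable B -> mu B = nu B.

Definition madd mu nu : pmeas R X := fun B => mu B + nu B.

Definition msupport mu : set X :=
  [set x | forall U : set X, open U -> U x -> 0 < mu U].

Definition concentrated mu (E : set X) := mu.-negligible (~` E : set (borelT X)).

Definition mut_singular mu nu :=
  exists B : set (borelT X), [/\ measurable B, mu B = 0 & nu (~` B) = 0].

Definition mint mu (f : X -> R) : \bar R := \int[mu]_x (f x)%:E.

Variable kappa : X -> X -> \bar R.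

Definition kpot (x : X) nu : \bar R := \int[nu]_y kappa x y.
Definition kmut nu nu1 : \bar R := \int[nu]_x kpot x nu1.

Definition finite_energy nu := radon nu /\ kmut nu nu < +oo.

(* A real (signed) measure is handled through a pair (p, n) of positive
   measures, meaning p - n.  The pair (p, n) represents an element of E
   when p, n in E^+ (then p - n is in E and all quantities below are the
   ones obtained by bilinearity). *)
Definition pairE p n := [/\ finite_energy p, finite_energy n & kmut p n < +oo].

(* kappa(p1 - n1, p2 - n2) by bilinearity *)
Definition kbil p1 n1 p2 n2 : \bar R :=
  kmut p1 p2 - kmut p1 n2 - kmut n1 p2 + kmut n1 n2.

(* ||p1 - n1 - (p2 - n2)||^2 *)
Definition dist2 p1 n1 p2 n2 : \bar R :=
  kbil (madd p1 n2) (madd n1 p2) (madd p1 n2) (madd n1 p2).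

Definition kpot_s (x : X) p n : \bar R := kpot x p - kpot x n.

Definition icap (E : set X) : \bar R :=
  (ereal_inf [set kmut nu nu | nu in
      [set nu | finite_energy nu /\ concentrated nu E /\ nu setT = 1]])^-1.

Definition nearly_everywhere (P : X -> Prop) (E : set X) :=
  exists N : set X, icap N = 0 /\ forall x, E x -> ~ N x -> P x.

Definition directed (D : Type) (le : D -> D -> Prop) :=
  [/\ exists d : D, True, (forall s, le s s),
      (forall s t u, le s t -> le t u -> le s u) &
      (forall s t, exists u, le s u /\ le t u)].

Definition Cc (f : X -> R) :=
  continuous f /\ compact (closure [set x | f x != 0%R]).

Definition vague_conv (D : Type) (le : D -> D -> Prop) (nus : D -> pmeas R X) nu :=
  forall f, Cc f -> forall e : R, (0 < e)%R -> exists s0, forall s, le s0 s ->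
    `| mint (nus s) f - mint nu f | < e%:E.

Definition vague_cluster (D : Type) (le : D -> D -> Prop) (nus : D -> pmeas R X) nu :=
  forall fs : seq (X -> R), (forall f, f \in fs -> Cc f) ->
  forall e : R, (0 < e)%R -> forall s0, exists s, le s0 s /\
    forall f, f \in fs -> `| mint (nus s) f - mint nu f | < e%:E.

Definition strong_cauchy (D : Type) (le : D -> D -> Prop) (nus : D -> pmeas R X) :=
  forall e : R, (0 < e)%R -> exists s0, forall s t, le s0 s -> le s0 t ->
    dist2 (nus s) (fun _ => 0) (nus t) (fun _ => 0) < e%:E.

Definition kernel_basic :=
  [/\ (forall x y, 0 <= kappa x y),
      lower_semicontinuous (fun xy : X * X => kappa xy.1 xy.2) &
      (forall x y, kappa x y = kappa y x)].

Definition strictly_pos_def :=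
  forall p n, pairE p n ->
    0 <= kbil p n p n /\ (kbil p n p n = 0 -> meas_eq p n).

Definition consistent :=
  forall (D : Type) (le : D -> D -> Prop) (nus : D -> pmeas R X),
    directed le -> (forall s, finite_energy (nus s)) -> strong_cauchy le nus ->
    forall nu, radon nu -> vague_cluster le nus nu ->
      finite_energy nu /\
      forall e : R, (0 < e)%R -> exists s0, forall s, le s0 s ->
        dist2 (nus s) (fun _ => 0) nu (fun _ => 0) < e%:E.

Definition kernel_finite_cont_offdiag :=
  forall x y, x <> y -> kappa x y < +oo /\
    {for (x, y), continuous (fun xy : X * X => kappa xy.1 xy.2)}.

Definition kernel_vanish_infty :=
  forall (e : R) (K : set X), (0 < e)%R -> compact K ->
    exists K' : set X, compact K' /\
      forall x y, K x -> ~ K' y -> kappa x y < e%:E.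

Definition gen_max_principle (h : R) :=
  (1 <= h)%R /\
  forall nu, radon nu -> compact (msupport nu) -> msupport nu !=set0 ->
    let M := ereal_sup [set kpot x nu | x in msupport nu] in
    M < +oo -> forall x, kpot x nu <= h%:E * M.

End potential_theory.

Section condenser.
Context {R : realType} {X : ptopologicalType} {I : countType}.
Variables (kappa : X -> X -> \bar R) (alpha : I -> bool) (A : I -> set X).
(* alpha i = true  <->  i in I^+ ;  alpha i = false  <->  i in I^- *)

Definition Aplus : set X := \bigcup_(i in [set i | alpha i]) A i.
Definition Aminus : set X := \bigcup_(i in [set i | ~~ alpha i]) A i.
Definition Aall : set X := \bigcup_(i in setT) A i.

Definition condenser :=
  [/\ (forall i, closed (A i) /\ A i !=set0),
      (forall x : X, exists U, nbhs x U /\ finite_set [set i | A i `&` U !=set0]),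
      (forall i j, alpha i -> ~~ alpha j -> A i `&` A j = set0) &
      (exists M : R, forall x y, Aplus x -> Aminus y -> kappa x y <= M%:E)].

Implicit Types mu : I -> pmeas R X.

(* R mu = Rplus mu - Rminus mu *)
Definition Rplus mu : pmeas R X := fun B => \esum_(i in [set i | alpha i]) mu i B.
Definition Rminus mu : pmeas R X := fun B => \esum_(i in [set i | ~~ alpha i]) mu i B.

Definition EplusA mu :=
  (forall i, radon (mu i) /\ concentrated (mu i) (A i)) /\
  pairE kappa (Rplus mu) (Rminus mu).

Definition normA2 mu : \bar R :=
  kbil kappa (Rplus mu) (Rminus mu) (Rplus mu) (Rminus mu).

Variables (chip chin : pmeas R X).
(* the external field chi = chip - chin (Jordan decomposition) *)
Definition external_field :=
  [/\ radon chip, radon chin, mut_singular chip chin &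
      chip setT < +oo /\ chin setT < +oo] /\
  [/\ pairE kappa chip chin,
      msupport chip `&` Aminus = set0 &
      msupport chin `&` Aplus = set0].

Definition Gchi mu : \bar R :=
  normA2 mu + 2%:E * kbil kappa chip chin (Rplus mu) (Rminus mu).

Definition Wpot mu (i : I) (x : X) : \bar R :=
  (if alpha i then 1 else -1) *
  kpot_s kappa x (madd chip (Rplus mu)) (madd chin (Rminus mu)).

Variables (g : X -> R) (a : I -> R).

Definition ginf : R := inf [set g x | x in Aall].

Definition constraint_g :=
  [/\ {within Aall, continuous g}, (0 < ginf)%R &
      forall i, (exists M : R, forall x, A i x -> (g x <= M)%R) \/
        exists (r : R) (p n : pmeas R X), (1 < r)%R /\ pairE kappa p n /\
          nearly_everywhere kappa
            (fun x => ((g x) `^ r)%:E <= kpot_s kappa x p n) (A i)].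

Definition constraint_a :=
  (forall i, (0 < a i)%R) /\ \esum_(i in setT) (a i)%:E < +oo.

Definition Feasible mu := EplusA mu /\ forall i, mint (mu i) g = (a i)%:E.

Definition Gmin : \bar R := ereal_inf [set Gchi mu | mu in Feasible].

Definition Hbound (h : R) : R :=
  (h * (fine (chip setT) + 2 * ginf^-1 * fine (\esum_(i in setT) (a i)%:E)))%R.

Definition minimizing_net (h : R) (D : Type) (le : D -> D -> Prop)
    (mus : D -> I -> pmeas R X) :=
  [/\ directed le,
      (forall s, Feasible (mus s)),
      (forall s, \esum_(i in setT) mus s i setT <= (Hbound h)%:E) &
      (forall e : R, (0 < e)%R -> exists s0, forall s, le s0 s ->
          `| Gchi (mus s) - Gmin | < e%:E)].

Definition extremal (h : R) (gam : I -> pmeas R X) :=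
  EplusA gam /\
  exists (D : Type) (le : D -> D -> Prop) (mus : D -> I -> pmeas R X),
    [/\ minimizing_net h le mus,
        (forall e : R, (0 < e)%R -> exists s0, forall s, le s0 s ->
           dist2 kappa (Rplus (mus s)) (Rminus (mus s)) (Rplus gam) (Rminus gam)
             < e%:E) &
        (forall i, vague_conv le (fun s => mus s i) (gam i))].

End condenser.

(* unordered sum over the countable index set of an extended-real family:
   sum of positive parts minus sum of negative parts *)
Definition csum {R : realType} {I : countType} (c : I -> \bar R) : \bar R :=
  \esum_(i in setT) maxe (c i) 0 - \esum_(i in setT) maxe (- c i) 0.

(* Main.v *)
Require Import Defs.
From HB Require Import structures.
From mathcomp Require Import all_boot all_order all_algebra.
From mathcomp Require Import all_classical all_reals all_analysis.
From mathcomp Require Import measurable_realfun.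
From mathcomp Require Import lra ring.

(** Since minimizing nets converge strongly to [gam], the functional [Gchi] is
    continuous along them and [Gchi gam] equals the minimum; the first relation
    is then bilinearity of the mutual energy. For the second one, replace
    [mu_s^i] by [(1 - t) mu_s^i + t nu] with [\int g dnu = a_i], pass to the limit
    in [s] and then let [t] tend to [0]: this gives [\int W^i dnu >= \int W^i dgam^i]
    for every such [nu] of finite energy, so the set where the inequality fails
    carries no measure of finite energy. The limit in [s] needs [mu_s^i] to
    converge weakly to [gam^i], which consistency provides: the energies are
    bounded, and elements of almost minimal norm in the convex hulls of the tails
    form a strong Cauchy net with vague limit [gam^i]. Uniqueness follows by
    integrating [a_i W^i >= eta_i g] against [mu_s^i], which yields
    [eta_i <= \int W^i dgam^i] in the limit, and comparing the sums.

    No countability is assumed on the space, so the symmetry of the mutual energy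
    and the finiteness of mutual energies are not consequences of the product
    measure theory; they are derived from lower semicontinuity by compactness
    and from the maximum principle. *)

Set Implicit Arguments.
Unset Strict Implicit.
Unset Printing Implicit Defensive.
Import Order.TTheory GRing.Theory Num.Theory numFieldNormedType.Exports.

Local Open Scope classical_set_scope.
Local Open Scope ring_scope.
Local Open Scope ereal_scope.

(** * Radon measures *)

Section raw_measures.
Context {R : realType} {X : ptopologicalType}.
Implicit Types (mu nu : pmeas R X).
Import HBNNSimple.

(** The measure [gam] need not be feasible: mass may escape in the vague limit, and then
    [\int g dgam^i] drops below [a_i]. So neither the variation nor the comparison with [eta_i] is
    carried out on [gam]; both take place on [mu_s], where the constraint is exact, and only the
    resulting inequalities go to the limit. A second obstacle is that strong convergence concerns
    [R mu_s] and does not by itself control single components, since plates of equal sign may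
    overlap. It does bound [||R mu_s||]. Because [kappa] is bounded on A^+ x A^-, the cross energy
    of the positive and negative parts is bounded as well, hence so are the energies of both parts
    and, [kappa] being nonnegative, of every component. This bound and the vague convergence are the
    input of the weak convergence argument. *)

Lemma open_borel (U : set X) : open U -> measurable (U : set (borelT X)).
Proof. by move=> oU; exact: sub_sigma_algebra. Qed.

Lemma closed_borel (F : set X) : closed F -> measurable (F : set (borelT X)).
Proof.
move=> cF; rewrite -(setCK F); apply: measurableC; apply: open_borel.
exact: closed_openC.
Qed.

Lemma compact_borel (K : set X) : hausdorff_space X -> compact K ->
  measurable (K : set (borelT X)).
Proof. by move=> hX cK; apply: closed_borel; exact: compact_closed. Qed.

Lemma lsc_measurable (f : X -> \bar R) : lower_semicontinuous f ->
  measurable_fun [set: borelT X] f.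
Proof.
move=> scif; apply: (measurability _ (ErealGenOInfty.measurableE R)).
move=> /= _ [_ [a ->]] <-; apply: measurableI => //; apply: open_borel.
by rewrite preimage_itvoy; move/lower_semicontinuousP : scif; exact.
Qed.

(** An integral evaluates its set function only on level sets of simple functions, and these are
    Borel. This lets [mrep] below stand in for the given set functions in all potentials and
    energies. *)
Lemma eq_pmeas_integral mu nu (f : X -> \bar R) :
  meas_eq mu nu -> \int[mu]_x f x = \int[nu]_x f x.
Proof.
move=> eqmn.
suff H (h : {nnsfun (borelT X) >-> R}) : sintegral mu h = sintegral nu h.
  by rewrite /integral; congr (ereal_sup _ - ereal_sup _); apply/seteqP; split;
    move=> _ [h /= hf <-]; exists h.
rewrite /sintegral; apply: eq_fsbigr => r _; congr (_ * _).
exact: eqmn.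
Qed.

Lemma eq_kpot (kappa : X -> X -> \bar R) mu nu x : meas_eq mu nu ->
  kpot kappa x mu = kpot kappa x nu.
Proof. by move=> e; exact: eq_pmeas_integral. Qed.

Lemma eq_kmut (kappa : X -> X -> \bar R) mu nu mu' nu' :
  meas_eq mu mu' -> meas_eq nu nu' ->
  kmut kappa mu nu = kmut kappa mu' nu'.
Proof.
move=> e1 e2; rewrite /kmut (eq_pmeas_integral _ e1).
by congr (integral _ _ _); apply/funext => x; exact: eq_kpot.
Qed.

Lemma meas_eq_sym mu nu : meas_eq mu nu -> meas_eq nu mu.
Proof. by move=> e B mB; rewrite e. Qed.

(* [radon] does not constrain the values on non-Borel sets, which the measure
   structure requires to be nonnegative. *)
Definition mrep mu : set (borelT X) -> \bar R :=
  fun B => if `[< radon mu /\ measurable B >] then mu B else 0.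

Let mrep0 mu : mrep mu set0 = 0.
Proof. by rewrite /mrep; case: asboolP => // -[[[]]]. Qed.

Let mrep_ge0 mu B : 0 <= mrep mu B.
Proof. by rewrite /mrep; case: asboolP => // -[[[_ + _] _]] => /[apply]. Qed.

Let mrep_sigma_additive mu : semi_sigma_additive (mrep mu).
Proof.
move=> F mF tF mU; rewrite /mrep; case: asboolP => [[rmu _]|nr].
  have [[_ _ sa] _] := rmu.
  rewrite (_ : (fun n => _) = (fun n => \sum_(0 <= i < n) mu (F i))).
    exact: sa.
  apply/funext => n; apply: eq_bigr => i _; case: asboolP => // -[].
  by split.
rewrite (_ : (fun n => _) = cst 0); first exact: cvg_cst.
apply/funext => n; apply: big1 => i _; case: asboolP => // -[rmu _].
by exfalso; apply: nr; split.
Qed.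

HB.instance Definition _ mu := isMeasure.Build _ _ _ (mrep mu)
  (mrep0 mu) (mrep_ge0 mu) (@mrep_sigma_additive mu).

Lemma mrepE mu : radon mu -> meas_eq (mrep mu) mu.
Proof. by move=> rmu B mB; rewrite /mrep; case: asboolP => // -[]. Qed.

Lemma radon_ext mu nu : hausdorff_space X -> meas_eq mu nu -> radon mu -> radon nu.
Proof.
move=> hX e [[m0 mge ms] [mK mout minn]]; have e0 := e _ (@measurable0 _ (borelT X)).
split; split.
- by rewrite -e0.
- by move=> B mB; rewrite -e//; exact: mge.
- move=> F mF tF mU; rewrite -e//.
  rewrite (_ : (fun n => _) = (fun n => \sum_(0 <= i < n) mu (F i))).
    exact: ms.
  by apply/funext => n; apply: eq_bigr => i _; rewrite e.
- by move=> K cK; rewrite -e; [exact: mK|exact: compact_borel].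
- move=> B mB; rewrite -e// mout//; congr ereal_inf.
  by apply/seteqP; split=> _ [U /= [oU BU] <-]; exists U => //;
    rewrite e//; exact: open_borel.
- move=> U oU; rewrite -e; last exact: open_borel.
  rewrite minn//; congr ereal_sup.
  by apply/seteqP; split=> _ [K /= [cK KU] <-]; exists K => //;
    rewrite e//; exact: compact_borel.
Qed.

End raw_measures.

Notation mea R X := {measure set (borelT X) -> \bar R}.

(** * Finite Radon measures *)

Section finite_radon.
Context {R : realType} {X : ptopologicalType}.
Hypothesis hX : hausdorff_space X.
Implicit Types (m n : mea R X).

Definition mplus m n : mea R X := measure_add m n.

Lemma mplusE m n B : mplus m n B = m B + n B.
Proof. exact: measure_addE. Qed.

(* multiplication by [|k|], so that [k] need not carry a sign proof *)
Definition mmul (k : R) m : mea R X := mscale (`|k|%:nng)%R m.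

Lemma mmulE k m B : (0 <= k)%R -> mmul k m B = k%:E * m B.
Proof. by move=> k0; rewrite -[LHS]/((`|k|%R)%:E * m B) ger0_norm. Qed.

Definition mres m (D : set (borelT X)) (mD : measurable D) : mea R X :=
  mrestr m mD.

Lemma mresE m D (mD : measurable D) B : mres m mD B = m (B `&` D).
Proof. by []. Qed.

(** Regularity in difference form: unlike the infimum and the supremum in [radon], it passes at once
    to dominated measures, restrictions and sums. *)
Definition finite_radon m := [/\ m setT < +oo,
  (forall (B : set (borelT X)) (e : R), measurable B -> (0 < e)%R ->
     exists U : set X, [/\ open U, B `<=` U & m (U `\` B) < e%:E]) &
  (forall (U : set X) (e : R), open U -> (0 < e)%R ->
     exists K : set X, [/\ compact K, K `<=` U & m (U `\` K) < e%:E])].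

Lemma finite_measure_lty m (B : set (borelT X)) : m setT < +oo -> measurable B -> m B < +oo.
Proof.
move=> mT mB; apply: le_lt_trans mT; apply: le_measure; rewrite ?inE//.
Qed.

Lemma finite_measure_fin_num m (B : set (borelT X)) : m setT < +oo -> measurable B -> m B \is a fin_num.
Proof. by move=> mT mB; rewrite ge0_fin_numE//; exact: finite_measure_lty. Qed.

Lemma radon_finite_radon m : m setT < +oo -> radon m -> finite_radon m.
Proof.
move=> mT [_ [_ mout minn]]; split => //.
- move=> B e mB e0.
  have mBf : m B \is a fin_num by exact: finite_measure_fin_num.
  have /ereal_inf_lt : ereal_inf [set m U | U in [set U : set X | open U /\ B `<=` U]]
      < m B + e%:E by rewrite -mout// lteDl// lte_fin.
  move=> [_ [U /= [oU BU] <-]] mU; exists U; split => //.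
  have mmU := open_borel oU.
  rewrite measureD//; last exact: finite_measure_lty.
  by rewrite setIidr// lteBlDr// addeC.
- move=> U e oU e0; have mU := open_borel oU.
  have mUf : m U \is a fin_num by exact: finite_measure_fin_num.
  have /ereal_sup_gt : m U - e%:E <
      ereal_sup [set m K | K in [set K : set X | compact K /\ K `<=` U]].
    by rewrite -minn// lteBlDr// lteDl// lte_fin.
  move=> [_ [K /= [cK KU] <-]] mK; exists K; split => //.
  have mmK := compact_borel hX cK.
  rewrite measureD//; last exact: finite_measure_lty.
  rewrite setIidr// lteBlDr//; last exact: finite_measure_fin_num.
  by rewrite addeC -lteBlDr.
Qed.

Lemma finite_radon_radon m : finite_radon m -> radon m.
Proof.
move=> [mT mout minn]; split; split.
- exact: measure0.
- by move=> B _; exact: measure_ge0.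
- exact: measure_semi_sigma_additive.
- by move=> K cK; apply: finite_measure_lty => //; exact: compact_borel.
- move=> B mB; apply/eqP; rewrite eq_le; apply/andP; split.
    apply/le_ereal_inf_tmp => _ [U /= [oU BU] <-].
    by apply: le_measure => //; rewrite inE//; exact: open_borel.
  apply/lee_addgt0Pr => e e0; have [U [oU BU mU]] := mout B e mB e0.
  have mmU := open_borel oU.
  apply: (@le_trans _ _ (m U)); first by apply: ereal_inf_lbound; exists U.
  rewrite -(setDUK BU) measureU//; last by rewrite setDIK.
    by rewrite leeD2l// ltW.
  exact: measurableD.
- move=> U oU; apply/eqP; rewrite eq_le; apply/andP; split; last first.
    apply: ge_ereal_sup => _ [K /= [cK KU] <-].
    by apply: le_measure => //; rewrite inE; [exact: compact_borel|exact: open_borel].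
  apply/lee_addgt0Pr => e e0; have [K [cK KU mK]] := minn U e oU e0.
  have mmK := compact_borel hX cK; have mmU := open_borel oU.
  apply: (@le_trans _ _ (m K + e%:E)); last first.
    by rewrite leeD2r//; apply: ereal_sup_ubound; exists K.
  rewrite -(setDUK KU) measureU//; last by rewrite setDIK.
    by rewrite leeD2l// ltW.
  exact: measurableD.
Qed.

Lemma finite_radon_le m n : (forall B, measurable B -> m B <= n B) -> finite_radon n -> finite_radon m.
Proof.
move=> mn [nT nout ninn]; split; first exact: le_lt_trans (mn _ _) nT.
- move=> B e mB e0; have [U [oU BU nU]] := nout B e mB e0; exists U; split => //.
  by apply: le_lt_trans nU; apply: mn; apply: measurableD => //; exact: open_borel.
- move=> U e oU e0; have [K [cK KU nK]] := ninn U e oU e0; exists K; split => //.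
  apply: le_lt_trans nK; apply: mn; apply: measurableD; first exact: open_borel.
  exact: compact_borel.
Qed.

Lemma finite_radon_add m n : finite_radon m -> finite_radon n -> finite_radon (mplus m n).
Proof.
move=> [mT mout minn] [nT nout ninn]; split.
- by rewrite mplusE lte_add_pinfty.
- move=> B e mB e0; have e2 : (0 < e / 2)%R by rewrite divr_gt0.
  have [U [oU BU mU]] := mout B _ mB e2; have [V [oV BV nV]] := nout B _ mB e2.
  exists (U `&` V); split; [exact: openI| by rewrite subsetI|].
  have mmU := open_borel oU; have mmV := open_borel oV.
  rewrite mplusE (splitr e) EFinD; apply: lteD.
    apply: le_lt_trans mU; apply: le_measure; rewrite ?inE.
    + by apply: measurableD => //; exact: measurableI.
    + exact: measurableD.
    + by apply: setSD; exact: subIsetl.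
  apply: le_lt_trans nV; apply: le_measure; rewrite ?inE.
    + by apply: measurableD => //; exact: measurableI.
    + exact: measurableD.
    + by apply: setSD; exact: subIsetr.
- move=> U e oU e0; have e2 : (0 < e / 2)%R by rewrite divr_gt0.
  have [K [cK KU mK]] := minn U _ oU e2; have [L [cL LU nL]] := ninn U _ oU e2.
  exists (K `|` L); split; [exact: compactU| by rewrite subUset|].
  have mmU := open_borel oU; have mmK := compact_borel hX cK.
  have mmL := compact_borel hX cL.
  rewrite mplusE (splitr e) EFinD; apply: lteD.
    apply: le_lt_trans mK; apply: le_measure; rewrite ?inE.
    + by apply: measurableD => //; exact: measurableU.
    + exact: measurableD.
    + by apply: setDS; exact: subsetUl.
  apply: le_lt_trans nL; apply: le_measure; rewrite ?inE.
    + by apply: measurableD => //; exact: measurableU.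
    + exact: measurableD.
    + by apply: setDS; exact: subsetUr.
Qed.

Lemma finite_radon_mul k m : (0 <= k)%R -> finite_radon m -> finite_radon (mmul k m).
Proof.
move=> k0 [mT mout minn].
(* The divisor [k + 1] instead of [k] covers [k = 0]. *)
have k1 : (0 < k + 1)%R by rewrite ltr_wpDl.
have kk (e : R) (B : set (borelT X)) : (0 < e)%R -> measurable B ->
    m B < (e / (k + 1))%:E -> mmul k m B < e%:E.
  move=> e0 mB; rewrite mmulE// -(fineK (finite_measure_fin_num mT mB)) -EFinM !lte_fin.
  rewrite ltr_pdivlMr// => h; apply: le_lt_trans h.
  rewrite mulrC ler_wpM2l ?fine_ge0//.
  by rewrite lerDl.
split.
- by rewrite mmulE// lte_mul_pinfty// lee_fin.
- move=> B e mB e0; have [|U [oU BU mU]] := mout B (e / (k + 1))%R mB.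
    by rewrite divr_gt0.
  exists U; split => //; apply: kk => //.
  by apply: measurableD => //; exact: open_borel.
- move=> U e oU e0; have [|K [cK KU mK]] := minn U (e / (k + 1))%R oU.
    by rewrite divr_gt0.
  exists K; split => //; apply: kk => //.
  by apply: measurableD => //; [exact: open_borel|exact: compact_borel].
Qed.

Lemma finite_radon_res m (D : set (borelT X)) (mD : measurable D) : finite_radon m ->
  finite_radon (mres m mD).
Proof.
apply: finite_radon_le => B mB; rewrite mresE; apply: le_measure; rewrite ?inE//.
exact: measurableI.
Qed.

(** From open sets to Borel sets: enclose the complement of [B] in an open [U] of small excess,
    choose a compact set of almost full mass, and remove [U] from it. *)
Lemma finite_radon_inner m (B : set (borelT X)) (e : R) : finite_radon m -> measurable B -> (0 < e)%R ->
  exists K : set X, [/\ compact K, K `<=` B & m (B `\` K) < e%:E].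
Proof.
move=> [mT mout minn] mB e0; have e2 : (0 < e / 2)%R by rewrite divr_gt0.
have [U [oU BU mU]] := mout (~` B) _ (measurableC mB) e2.
have [K [cK _ mK]] := minn setT _ openT e2.
have mmU := open_borel oU; have mmK := compact_borel hX cK.
exists (K `\` U); split.
- apply: (subclosed_compact _ cK); last exact: subDsetl.
  apply: closedI; first exact: compact_closed.
  exact: open_closedC.
- by move=> x [_ nUx]; apply: contrapT => nBx; apply: nUx; exact: BU.
- apply: (@le_lt_trans _ _ (m ((U `\` ~` B) `|` (setT `\` K)))).
    apply: le_measure; rewrite ?inE.
    + by apply: measurableD => //; exact: measurableD.
    + apply: measurableU; apply: measurableD => //; exact: measurableC.
    + move=> x [Bx nKU]; have [Kx|nKx] := pselect (K x); [left|right] => //.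
      by split; [apply: contrapT => nUx; apply: nKU|move=> /(_ Bx)].
  apply: (@le_lt_trans _ _ (m (U `\` ~` B) + m (setT `\` K))).
    apply: measureU2; apply: measurableD => //; exact: measurableC.
  by rewrite [in ltRHS](splitr e) EFinD; exact: lteD.
Qed.

End finite_radon.

(** * Comparison of integrals with superadditive set functions *)

Section integral_generic.
Context d (T : measurableType d) (R : realType) (mu : {measure set T -> \bar R}).
Import HBNNSimple.

Lemma nnsfun_setC_null (D : set T) (mD : measurable D) (h : {nnsfun T >-> R}) :
  mu (~` D) = 0 -> sintegral mu h = sintegral mu (proj_nnsfun h mD).
Proof.
move=> D0; rewrite -integralT_nnsfun.
rewrite (@ge0_negligible_integral _ _ _ mu setT (~` D))//.
- rewrite setTD setCK integral_nnsfun// mrestrict.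
  by congr sintegral; apply/funext => x.
- exact: measurableC.
- exact/measurable_EFinP.
- by move=> x _; rewrite lee_fin.
Qed.

(* [f] may be non-measurable: the integral is a supremum over simple functions. *)
Lemma integral_setC_null (D : set T) (f : T -> \bar R) :
  measurable D -> mu (~` D) = 0 -> \int[mu]_x f x = \int[mu]_(x in D) f x.
Proof.
move=> mD D0; rewrite /integral patch_setT funepos_restrict funeneg_restrict.
suff H (k : T -> \bar R) : (forall x, 0 <= k x) ->
    ereal_sup [set sintegral mu h | h in
      [set h : {nnsfun T >-> R} | forall x, (h x)%:E <= k x]] =
    ereal_sup [set sintegral mu h | h in
      [set h : {nnsfun T >-> R} | forall x, (h x)%:E <= (k \_ D) x]].
  by congr (_ - _); apply: H => x; rewrite ?funepos_ge0 ?funeneg_ge0.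
move=> k0; apply/eqP; rewrite eq_le; apply/andP; split.
- apply: ge_ereal_sup => _ [h /= hk <-]; apply: ereal_sup_ubound.
  exists (proj_nnsfun h mD); last by rewrite -nnsfun_setC_null.
  move=> x; have -> : proj_nnsfun h mD x = (h \_ D) x by rewrite mrestrict.
  by rewrite /patch; case: ifPn.
- apply: ereal_sup_le => _ [h /= hk <-]; exists h => // x.
  by apply: (le_trans (hk x)); rewrite /patch; case: ifPn.
Qed.

(** A simple function below [f] is summed over its level sets; on the level set of [x > 0], a factor
    [r < 1] gives the strict bound [r * x < f], and [r] tends to 1. Strictness is the point: for a
    lower semicontinuous [f] it is an open condition. The estimates that replace product measure
    theory are all instances with a suitable [l]. *)
Lemma integral_le_superadditive (f : T -> \bar R) (l : set T -> \bar R) :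
  (forall x, 0 <= f x) ->
  (forall B, measurable B -> 0 <= l B) ->
  (forall A B, measurable A -> measurable B -> [disjoint A & B] ->
    l A + l B <= l (A `|` B)) ->
  (forall (c : R) B, (0 < c)%R -> measurable B -> (forall x, B x -> c%:E < f x) ->
    c%:E * mu B <= l B) ->
  \int[mu]_x f x <= l setT.
Proof.
move=> f0 l0 lU H; rewrite ge0_integralTE//; apply: ge_ereal_sup => _ [h /= hf <-].
pose D (s : seq R) := h @^-1` [set` s].
have DE x s : D (x :: s) = h @^-1` [set x] `|` D s.
  apply/seteqP; split => t /=; rewrite /D /=.
    by rewrite inE => /orP[/eqP ->|ts]; [left|right].
  by case=> [->|ts]; rewrite inE ?eqxx// ts orbT.
have mD s : measurable (D s).
  elim: s => [|x s ih]; first by rewrite /D set_nil preimage_set0.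
  by rewrite DE; exact: measurableU.
have key s : uniq s -> (forall x, x \in s -> 0 <= x)%R ->
    \sum_(x <- s) x%:E * mu (h @^-1` [set x]) <= l (D s).
  elim: s => [|x s ih] /=; first by rewrite big_nil l0.
  move=> /andP[xs us] s0; rewrite big_cons DE.
  apply: (le_trans _ (lU _ _ _ _ _)) => //; last first.
    rewrite disj_set2E; apply/eqP/seteqP; split => // t [/= hx]; rewrite /D /= hx.
    by rewrite (negbTE xs).
  apply: leeD; last by apply: ih => // y ys; apply: s0; rewrite inE ys orbT.
  have : (0 <= x)%R by apply: s0; rewrite mem_head.
  rewrite le_eqVlt => /predU1P[<-|x0]; first by rewrite mul0e l0.
  apply/lee_mul01Pr; first by rewrite mule_ge0// lee_fin ltW.
  move=> r /andP[r0 r1]; rewrite muleA -EFinM; apply: H => //.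
    by rewrite mulr_gt0.
  move=> t /= ht; apply: lt_le_trans (hf t); rewrite ht lte_fin.
  by rewrite gtr_pMl.
rewrite sintegralE fsbig_finite//=.
set s := finmap.enum_fset (fset_set (range h)).
have ks : \sum_(x <- s) x%:E * mu (h @^-1` [set x]) <= l (D s).
  apply: key; first exact: finmap.fset_uniq.
  by move=> x; rewrite in_fset_set// inE => -[t _ <-].
apply: (le_trans ks).
apply: (@le_trans _ _ (l (D s) + l (~` D s))).
  by rewrite leeDl// l0//; exact: measurableC.
apply: (le_trans (lU _ _ _ _ _)) => //; first exact: measurableC.
  by rewrite disj_set2E setICr.
by rewrite setUCr.
Qed.

End integral_generic.

Lemma ereal_sup_addP (R : realType) (S S' : set (\bar R)) (M : \bar R) :
  S !=set0 -> S' !=set0 -> (forall a, S a -> 0 <= a) -> (forall a, S' a -> 0 <= a) ->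
  (forall a b, S a -> S' b -> a + b <= M) -> ereal_sup S + ereal_sup S' <= M.
Proof.
move=> [s Ss] [s' Ss'] S0 S'0 H.
have M0 : 0 <= M by apply: le_trans (H _ _ Ss Ss'); exact: adde_ge0 (S0 _ Ss) (S'0 _ Ss').
case: M H M0 => [r||] H M0 //; last by rewrite leey.
have fin a : 0 <= a -> a <= r%:E -> a \is a fin_num.
  by move=> a0 ar; rewrite ge0_fin_numE//; apply: le_lt_trans ar (ltry _).
have finS a : S a -> a \is a fin_num.
  move=> Sa; apply: fin; first exact: S0.
  by apply: le_trans (H _ _ Sa Ss'); apply: leeDl; exact: S'0.
have finS' a : S' a -> a \is a fin_num.
  move=> Sa; apply: fin; first exact: S'0.
  by apply: le_trans (H _ _ Ss Sa); apply: leeDr; exact: S0.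
have sup1 b : S' b -> ereal_sup S <= r%:E - b.
  move=> Sb; apply: ge_ereal_sup => a Sa; rewrite leeBrDr ?finS'//.
  exact: H.
have supf : ereal_sup S \is a fin_num.
  apply: fin; first by apply: le_trans (ereal_sup_ubound Ss); exact: S0.
  apply: le_trans (sup1 _ Ss') _; by rewrite leeBlDr ?finS'//; apply: leeDl; exact: S'0.
rewrite addeC -leeBrDr//; apply: ge_ereal_sup => b Sb.
by rewrite leeBrDr// addeC -leeBrDr ?finS'//; exact: sup1.
Qed.

(** Finite subcovers as an induction principle. One of the two sets in the union step is open, hence
    Borel, so that a Borel set can be split along it. *)
Lemma compact_open_ind (T : ptopologicalType) (P : set T -> Prop) (K : set T) :
  compact K -> P set0 -> (forall S S', S `<=` S' -> P S' -> P S) ->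
  (forall U S, open U -> P U -> P S -> P (U `|` S)) ->
  (forall x, K x -> exists2 U : set T, open U /\ U x & P U) -> P K.
Proof.
move=> cK P0 PS PU Ploc; have : cover_compact K by rewrite -compact_cover.
move=> /(_ _ [set U : set T | open U /\ P U] id).
case=> [U []//||D DP KD].
  by move=> x /Ploc[U [oU Ux] PU']; exists U.
have {}DP U : U \in finmap.enum_fset D -> open U /\ P U.
  by move=> /DP; rewrite inE.
have KD' : K `<=` \bigcup_(U in [set` finmap.enum_fset D]) U by [].
move: (finmap.enum_fset D) DP KD' => s DP KD'; apply: (PS _ _ KD').
elim: s {KD'} DP => [|U s ih] DP; first by rewrite set_nil bigcup_set0.
have -> : \bigcup_(V in [set` U :: s]) V = U `|` \bigcup_(V in [set` s]) V.
  apply/seteqP; split => t.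
    by move=> [V /=]; rewrite inE => /orP[/eqP ->|Vs] Vt; [left|right; exists V].
  case=> [Ut|[V /= Vs Vt]]; first by exists U => //=; rewrite mem_head.
  by exists V => //=; rewrite inE Vs orbT.
have [oU PU'] := DP U (mem_head _ _).
by apply: PU => //; apply: ih => V Vs; apply: DP; rewrite inE Vs orbT.
Qed.

(** * Potentials of lower semicontinuous kernels *)

Section kernel_potential.
Context {R : realType} {X : ptopologicalType}.
Variable kappa : X -> X -> \bar R.
Hypothesis hX : hausdorff_space X.
Hypothesis hk : kernel_basic kappa.
Implicit Types (m n mu nu : mea R X).

Lemma kappa_ge0 x y : 0 <= kappa x y. Proof. by case: hk. Qed.

Lemma kappaC x y : kappa x y = kappa y x. Proof. by case: hk. Qed.

Lemma kappa_measurable x : measurable_fun [set: borelT X] (kappa x).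
Proof.
apply: lsc_measurable => y a ay; have [_ lsc _] := hk.
have [V [[A B] /= [nA nB] AB] HV] := lsc (x, y) a ay.
exists B => // z Bz; apply: (HV (x, z)); apply: AB; split => //=.
exact: nbhs_singleton nA.
Qed.

Lemma integral_mres m (D : set (borelT X)) (mD : measurable D) (f : X -> \bar R) :
  \int[mres m mD]_x f x = \int[m]_(x in D) f x.
Proof.
rewrite (@integral_setC_null _ _ _ (mres m mD) D)//; last first.
  by rewrite mresE setICl measure0.
apply: eq_measure_integral => A mA AD.
by rewrite mresE setIidl.
Qed.

(** The tube lemma for the open set [kappa > c]. *)
Lemma tube x (c : R) (K : set X) : compact K -> (forall y, K y -> c%:E < kappa x y) ->
  exists U : set X, [/\ open U, U x & forall x' y, U x' -> K y -> c%:E < kappa x' y].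
Proof.
move=> cK Kc; have [_ lsc _] := hk.
have : nbhs x [set x' | K `<=` (fun y => c%:E < kappa x' y)].
  apply: (iffLR (compact_near_coveringP K) cK _ (nbhs x)
    (fun x' y => c%:E < kappa x' y)) => y Ky.
  have [V [[A B] /= [nA nB] AB] HV] := lsc (x, y) c (Kc y Ky).
  exists (B, A) => //= -[u v] [/= Bu Av].
  by apply: (HV (v, u)); apply: AB.
rewrite nbhsE => -[U [oU Ux] HU]; exists U; split => // x' y Ux' Ky.
exact: (HU x' Ux' y Ky).
Qed.

(** Reduces the condition on level sets in [integral_le_superadditive] to compact sets, where
    covering arguments apply. *)
Lemma compact_approx_le nu (l : set (borelT X) -> \bar R) (c : R) (B : set (borelT X)) :
  finite_radon nu -> (0 < c)%R -> measurable B ->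
  (forall K : set X, compact K -> K `<=` B -> c%:E * nu K <= l B) ->
  c%:E * nu B <= l B.
Proof.
move=> fnu c0 mB H; apply/lee_addgt0Pr => e e0.
have [K [cK KB nK]] := finite_radon_inner hX fnu mB (divr_gt0 e0 c0).
have mK := compact_borel hX cK.
rewrite -(setDUK KB) measureU//; last 2 first.
- exact: measurableD.
- by rewrite setDIK.
rewrite ge0_muleDr// setDUK//; apply: leeD; first exact: H.
by rewrite muleC -lee_pdivlMr// ltW.
Qed.

(** One function [h] below [kappa x'] for all [x'] near [x] takes the place of Fatou's lemma, which
    concerns sequences. The functional [l] is the supremum of the integrals of such minorants. It is
    superadditive, since minorants can be glued along disjoint sets over the intersection of their
    neighborhoods; on a compact subset of [kappa x > c] the tube lemma makes [c] times the indicator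
    a minorant. *)
Lemma kpot_lower_fun nu x (t : R) : finite_radon nu -> t%:E < kpot kappa x nu ->
  exists (U : set X) (h : X -> \bar R),
    [/\ open U, U x & forall x' y, U x' -> h y <= kappa x' y] /\
    [/\ measurable_fun [set: borelT X] h, (forall y, 0 <= h y) &
        t%:E < \int[nu]_y h y].
Proof.
move=> fnu tx.
pose HH (h : X -> \bar R) := [/\ measurable_fun [set: borelT X] h,
  (forall y, 0 <= h y) &
  exists2 U : set X, open U /\ U x & forall x' y, U x' -> h y <= kappa x' y].
pose l (E : set (borelT X)) := ereal_sup [set \int[nu]_(y in E) h y | h in HH].
have H0 : HH (cst 0).
  split; [exact: measurable_cst|by []|exists setT => //; first by split; [exact: openT|]].
  by move=> x' y _; exact: kappa_ge0.
suff /(lt_le_trans tx) : kpot kappa x nu <= l setT.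
  move=> /ereal_sup_gt[_ [h [mh h0 [U [oU Ux] hU]] <-] th].
  by exists U, h.
apply: integral_le_superadditive.
- exact: kappa_ge0.
- move=> B mB; apply: ereal_sup_ubound; exists (cst 0) => //.
  by rewrite integral0.
- move=> A B mA mB AB; apply: ereal_sup_addP.
  + by eexists; exists (cst 0).
  + by eexists; exists (cst 0).
  + by move=> _ [h [_ h0 _] <-]; exact: integral_ge0.
  + by move=> _ [h [_ h0 _] <-]; exact: integral_ge0.
  move=> _ _ [h1 [mh1 h10 [U [oU Ux] hU]] <-] [h2 [mh2 h20 [V [oV Vx] hV]] <-].
  pose h y := if y \in A then h1 y else h2 y.
  have mh : measurable_fun [set: borelT X] h.
    apply: measurable_fun_ifT => //.
    by apply: (measurable_fun_bool true); rewrite setTI preimage_mem_true.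
  have h0 y : 0 <= h y by rewrite /h; case: ifP.
  apply: (@le_trans _ _ (\int[nu]_(y in A `|` B) h y)); last first.
    apply: ereal_sup_ubound; exists h => //; split => //; exists (U `&` V).
      by split; [exact: openI|].
    by move=> x' y [Ux' Vx']; rewrite /h; case: ifP => _; [exact: hU|exact: hV].
  rewrite ge0_integral_setU//; last exact: measurable_funS mh.
  rewrite le_eqVlt; apply/orP; left; apply/eqP; congr (_ + _).
    by apply: eq_integral => y yA; rewrite /h yA.
  apply: eq_integral => y; rewrite inE => yB; rewrite /h ifF//.
  apply/negP; rewrite inE => yA; move: AB; rewrite disj_set2E => /eqP.
  by apply/eqP/set0P; exists y.
- move=> c B c0 mB Bc; apply: compact_approx_le => // K cK KB.
  have [U [oU Ux UK]] := tube cK (fun y Ky => Bc y (KB y Ky)).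
  have mK := compact_borel hX cK.
  pose h y := c%:E * (\1_K y)%:E.
  have mi : measurable_fun [set: borelT X]
      (fun y : borelT X => (\1_(K : set (borelT X)) y)%:E : \bar R).
    by apply/measurable_EFinP; exact: measurable_indic.
  have mh : measurable_fun [set: borelT X] h by exact: measurable_funeM.
  have h0 y : 0 <= h y by rewrite /h mule_ge0// lee_fin ?ltW.
  apply: (@le_trans _ _ (\int[nu]_(y in B) h y)).
    rewrite /h ge0_integralZl//; last 2 first.
    + exact: (measurable_funTS mi).
    + by rewrite lee_fin ltW.
    by rewrite integral_indic// setIidl.
  apply: ereal_sup_ubound; exists h => //; split => //; exists U => // x' y Ux'.
  rewrite /h indicE; case: (boolP (y \in K)) => yK.
    by rewrite mule1 ltW// UK//; rewrite inE in yK.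
  by rewrite mule0 kappa_ge0.
Qed.

Lemma kpot_ge0 nu x : 0 <= kpot kappa x nu.
Proof. by apply: integral_ge0 => y _; exact: kappa_ge0. Qed.

Lemma kmut_ge0 mu nu : 0 <= kmut kappa mu nu.
Proof. by apply: integral_ge0 => y _; exact: kpot_ge0. Qed.

Lemma kpot_lsc nu : finite_radon nu -> lower_semicontinuous (fun x => kpot kappa x nu).
Proof.
move=> fnu x t tx; have [U [h [[oU Ux hU] [mh h0 th]]]] := kpot_lower_fun fnu tx.
exists U; first by rewrite nbhsE; exists U.
move=> y Uy; apply: lt_le_trans th _; apply: ge0_le_integral => //.
- exact: kappa_measurable.
- by move=> z _; exact: hU.
Qed.

Lemma kpot_measurable nu : finite_radon nu ->
  measurable_fun [set: borelT X] (fun x => kpot kappa x nu).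
Proof. by move=> fnu; apply: lsc_measurable; exact: kpot_lsc. Qed.

(** Half of Tonelli's theorem; [kappa] need not be measurable for the product of the Borel
    sigma-algebras. Near a point where the potential of [nu] exceeds [c], the minorant from
    [kpot_lower_fun] gives [c * mu E <= l E] for Borel [E], and a finite subcover extends this to
    compact sets. *)
Lemma kmut_leC mu nu : finite_radon mu -> finite_radon nu -> kmut kappa mu nu <= kmut kappa nu mu.
Proof.
move=> fmu fnu.
pose l (B : set (borelT X)) := \int[nu]_y \int[mu]_(x in B) kappa y x.
have ml (B : set (borelT X)) : measurable B ->
    measurable_fun [set: borelT X] (fun y => \int[mu]_(x in B) kappa y x).
  move=> mB; have := kpot_measurable (finite_radon_res hX mB fmu).
  by congr measurable_fun; apply/funext => y; rewrite /kpot integral_mres.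
have i0 (B : set (borelT X)) y : 0 <= \int[mu]_(x in B) kappa y x.
  by apply: integral_ge0 => x _; exact: kappa_ge0.
have l0 B : 0 <= l B by apply: integral_ge0 => y _; exact: i0.
have lU A B : measurable A -> measurable B -> [disjoint A & B] ->
    l A + l B = l (A `|` B).
  move=> mA mB AB; rewrite /l -ge0_integralD//; [|exact: ml|exact: ml].
  apply: eq_integral => y _; rewrite ge0_integral_setU//.
    exact: measurable_funTS (kappa_measurable y).
  by move=> x _; exact: kappa_ge0.
have lS A B : measurable A -> measurable B -> A `<=` B -> l A <= l B.
  move=> mA mB AB; rewrite -(setDUK AB) -lU//; first by rewrite leeDl.
    exact: measurableD.
  by rewrite disj_set2E setDIK.
apply: (@integral_le_superadditive _ _ _ mu _ l) => //.
- by move=> x; exact: kpot_ge0.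
- by move=> A B mA mB AB; rewrite lU.
move=> c B c0 mB Bc; apply: compact_approx_le => // K cK KB.
have mK := compact_borel hX cK.
apply: (@le_trans _ _ (l K)); last exact: lS.
(* Quantifying over all Borel subsets makes [P] pass to subsets, as the induction requires, and lets
   the pieces of a split set be treated separately. *)
pose P (S : set X) := forall E : set (borelT X), measurable E -> E `<=` S ->
  c%:E * mu E <= l E.
have Ploc x : K x -> exists2 U : set X, open U /\ U x & P U.
  move=> Kx; have [U [h [[oU Ux hU] [mh h0 th]]]] := kpot_lower_fun fnu (Bc _ (KB _ Kx)).
  exists U => // E mE EU.
  apply: (@le_trans _ _ (\int[nu]_y (h y * mu E))).
    rewrite ge0_integralZr// [leRHS]muleC [leLHS]muleC.
    by apply: lee_wpmul2l => //; exact: ltW.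
  apply: ge0_le_integral => //.
  + by move=> y _; rewrite mule_ge0.
  + by apply: emeasurable_funM => //; exact: measurable_cst.
  + exact: ml.
  + move=> y _; rewrite -(integral_cst mu mE); apply: ge0_le_integral => //.
    * by move=> z _; exact: h0.
    * exact: measurable_funTS (kappa_measurable y).
    * by move=> x' Ex'; rewrite kappaC; apply: hU; exact: EU.
have PU S U : open U -> P S -> P U -> P (U `|` S).
  move=> oU PS PU E mE ESU; have mU := open_borel oU.
  have EE : E = (E `&` U) `|` (E `&` ~` U) by rewrite -setIUr setUv setIT.
  have mEU : measurable (E `&` U) by exact: measurableI.
  have mEC : measurable (E `&` ~` U) by apply: measurableI => //; exact: measurableC.
  have dis : [disjoint E `&` U & E `&` ~` U].
    by rewrite disj_set2E setIACA setICr setI0.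
  rewrite [in leLHS]EE [in leRHS]EE -lU// measureU//; last by apply/eqP; rewrite -disj_set2E.
  rewrite ge0_muleDr//; apply: leeD; [apply: PU|apply: PS] => //.
  by move=> x [Ex nUx]; case: (ESU x) => //; right.
suff : P K by apply.
apply: (compact_open_ind cK) => //.
- by move=> E mE; rewrite subset0 => ->; rewrite measure0 mule0.
- by move=> S S' SS' PS E mE ES; apply: PS => //; exact: subset_trans SS'.
- by move=> U S oU PU' PS; exact: PU.
Qed.

Lemma kmutC mu nu : finite_radon mu -> finite_radon nu -> kmut kappa mu nu = kmut kappa nu mu.
Proof. by move=> fmu fnu; apply/eqP; rewrite eq_le !kmut_leC. Qed.

End kernel_potential.
(** * Energy *)

Section energy_form.
Context {R : realType} {X : ptopologicalType}.
Variables (kappa : X -> X -> \bar R) (h : R).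
Hypothesis hX : hausdorff_space X.
Hypothesis hk : kernel_basic kappa.
Hypothesis hka : strictly_pos_def kappa.
Hypothesis hke : gen_max_principle kappa h.
Implicit Types (m n p q mu nu : mea R X).

Let k0 := kappa_ge0 hk.
Let mk := kappa_measurable hk.

Lemma integral_mplus m n (f : X -> \bar R) : measurable_fun [set: borelT X] f ->
  (forall x, 0 <= f x) ->
  \int[mplus m n]_x f x = \int[m]_x f x + \int[n]_x f x.
Proof. by move=> mf f0; exact: ge0_integral_measure_add. Qed.

Lemma integral_mmul (t : R) m (f : X -> \bar R) : (0 <= t)%R ->
  measurable_fun [set: borelT X] f -> (forall x, 0 <= f x) ->
  \int[mmul t m]_x f x = t%:E * \int[m]_x f x.
Proof.
move=> t0 mf f0; rewrite /mmul ge0_integral_mscale//.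
by congr (_ * _); rewrite /= ger0_norm.
Qed.

Lemma kmut_plusl m n p : finite_radon p ->
  kmut kappa (mplus m n) p = kmut kappa m p + kmut kappa n p.
Proof.
move=> fp; rewrite /kmut integral_mplus//; first exact: kpot_measurable.
by move=> x; exact: kpot_ge0.
Qed.

Lemma kmut_mull t m p : (0 <= t)%R -> finite_radon p ->
  kmut kappa (mmul t m) p = t%:E * kmut kappa m p.
Proof.
move=> t0 fp; rewrite /kmut integral_mmul//; first exact: kpot_measurable.
by move=> x; exact: kpot_ge0.
Qed.

Lemma kpot_le m n x : (forall B, measurable B -> m B <= n B) ->
  kpot kappa x m <= kpot kappa x n.
Proof. by move=> mn; apply: ge0_le_measure_integral. Qed.

Lemma kmut_le m n p q : finite_radon n -> finite_radon q ->
  (forall B, measurable B -> m B <= n B) -> (forall B, measurable B -> p B <= q B) ->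
  kmut kappa m p <= kmut kappa n q.
Proof.
move=> fn fq mn pq; have fp := finite_radon_le hX pq fq.
apply: (@le_trans _ _ (kmut kappa m q)).
  apply: ge0_le_integral => //.
  - by move=> x _; exact: kpot_ge0.
  - exact: kpot_measurable.
  - exact: kpot_measurable.
  - by move=> x _; exact: kpot_le.
apply: ge0_le_measure_integral => //; first by move=> x; exact: kpot_ge0.
exact: kpot_measurable.
Qed.

Lemma mres_le m (D : set (borelT X)) (mD : measurable D) B : measurable B ->
  mres m mD B <= m B.
Proof.
by move=> mB; rewrite mresE; apply: le_measure; rewrite ?inE//; exact: measurableI.
Qed.

Lemma null_of_empty_support m (K : set X) : compact K ->
  msupport m `&` K = set0 -> m K = 0.
Proof.
move=> cK supp0; have mK := compact_borel hX cK.
suff [B [mB B0 KB]] : m.-negligible (K : set (borelT X)).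
  exact: subset_measure0 KB B0.
apply: (@compact_open_ind X (fun S => m.-negligible (S : set (borelT X)))) => //.
- by exists set0; split => //; exact: measure0.
- by move=> S S' SS' [B [mB B0 SB]]; exists B; split => //; exact: subset_trans SB.
- move=> U S oU [B [mB B0 UB]] [B' [mB' B0' SB']]; exists (B `|` B'); split.
  + exact: measurableU.
  + exact: null_set_setU.
  + exact: setUSS.
move=> x Kx; apply: contrapT => nx.
suff : (msupport m `&` K) x by rewrite supp0.
split=> // U oU Ux; rewrite lt0e measure_ge0 andbT; apply/eqP => mU0.
apply: nx; exists U => //; exists U; split => //; exact: open_borel.
Qed.

Lemma msupport_closed m : closed (msupport m).
Proof.
have -> : msupport m = ~` \bigcup_(U in [set U : set X | open U /\ ~ 0 < m U]) U.
  apply/seteqP; split => [x sx [U [oU mU] Ux]|x nx U oU Ux].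
    by apply: mU; exact: sx.
  by apply: contrapT => mU; apply: nx; exists U.
by apply: open_closedC; apply: bigcup_open => U [].
Qed.

(** Restriction to [K] lowers the potential, so it is at most [M] on the support, which lies in [K];
    the maximum principle extends this bound to the whole space at the cost of the factor [h]. *)
Lemma kpot_res_bounded m (K : set X) (mK : measurable (K : set (borelT X))) (M : R) :
  finite_radon m -> compact K -> (0 <= M)%R -> (forall x, K x -> kpot kappa x m <= M%:E) ->
  forall x, kpot kappa x (mres m mK) <= (h * M)%:E.
Proof.
move=> fm cK M0 KM x; have [h1 mp] := hke.
have h0 : (0 <= h)%R by apply: le_trans h1.
have sK : msupport (mres m mK) `<=` K.
  move=> y sy; apply: contrapT => nKy.
  have : 0 < mres m mK (~` K).
    by apply: sy => //; apply: closed_openC; exact: compact_closed.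
  by rewrite mresE setICl measure0 ltxx.
(* The maximum principle speaks of nonempty supports; a measure on [K] with empty support vanishes
   by compactness. *)
have [s0|] := eqVneq (msupport (mres m mK)) set0.
  have mK0 : m K = 0.
    rewrite -(setIid K) -mresE; apply: null_of_empty_support => //.
    by rewrite s0 set0I.
  rewrite /kpot integral_mres null_set_integral ?lee_fin ?mulr_ge0//.
  exact: measurable_funTS (mk x).
move=> /set0P sn.
have supM : ereal_sup [set kpot kappa x (mres m mK) | x in msupport (mres m mK)] <= M%:E.
  apply: ge_ereal_sup => _ [y sy <-]; apply: le_trans (KM _ (sK _ sy)).
  by apply: kpot_le => B mB; exact: mres_le.
apply: (@le_trans _ _ (h%:E * ereal_sup
  [set kpot kappa x (mres m mK) | x in msupport (mres m mK)])).
  apply: mp => //.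
  - by apply: finite_radon_radon => //; exact: finite_radon_res.
  - by apply: (subclosed_compact _ cK sK); exact: msupport_closed.
  - by apply: le_lt_trans supM _; rewrite ltry.
by rewrite EFinM lee_wpmul2l// lee_fin.
Qed.

(** Finite mass is included because it makes bounded potentials integrable; the finiteness of mutual
    energies rests on this. *)
Definition en m := finite_radon m /\ kmut kappa m m < +oo.

Lemma en_finite_energy m : en m -> finite_energy kappa m.
Proof. by move=> [fm mm]; split => //; exact: finite_radon_radon. Qed.

Lemma en_le m n : (forall B, measurable B -> m B <= n B) -> en n -> en m.
Proof.
move=> mn [fn nn]; split; first exact: finite_radon_le fn.
by apply: le_lt_trans nn; exact: kmut_le.
Qed.

Lemma kmut_pair_le n p : en n -> en p -> kmut kappa n p < +oo ->
  kmut kappa n p <= kmut kappa n n + kmut kappa p p.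
Proof.
move=> en_n en_p np; have [fn nn] := en_n; have [fp pp] := en_p.
have [|pd _] := @hka n p; first by split => //; exact: en_finite_energy.
move: pd; rewrite /kbil (kmutC hX hk fp fn).
have f1 : kmut kappa n n \is a fin_num by rewrite ge0_fin_numE// kmut_ge0.
have f2 : kmut kappa p p \is a fin_num by rewrite ge0_fin_numE// kmut_ge0.
have f3 : kmut kappa n p \is a fin_num by rewrite ge0_fin_numE// kmut_ge0.
have := kmut_ge0 hk n p.
rewrite -(fineK f1) -(fineK f2) -(fineK f3) -!EFinB -!EFinD !lee_fin.
by lra.
Qed.

(* Positive definiteness only bounds mutual energies already known to be finite.
   Restricting [m] to compact sets on which its potential is bounded makes that
   potential bounded everywhere, by the maximum principle; such sets exhaust [m]. *)
Lemma kmut_lty m n : en m -> en n -> kmut kappa m n < +oo.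
Proof.
move=> en_m en_n; have [fm mm] := en_m; have [fn nn] := en_n.
pose E (j : nat) : set (borelT X) := [set x | kpot kappa x m <= j%:R%:E].
have mE j : measurable (E j).
  have := emeasurable_fun_infty_c measurableT (kpot_measurable hX hk fm) j%:R%:E.
  by rewrite setTI.
have ndE i j : (i <= j)%N -> E i `<=` E j.
  by move=> ij x /= Ex; apply: (le_trans Ex); rewrite lee_fin ler_nat.
pose S (B : set (borelT X)) := [set K : set X | compact K /\ K `<=` B /\
  exists j, K `<=` E j].
pose f x := kpot kappa x n.
have mf : measurable_fun [set: borelT X] f by exact: kpot_measurable.
have f0 x : 0 <= f x by exact: kpot_ge0.
pose l B := ereal_sup [set \int[m]_(x in K) f x | K in S B].
pose B0 := kmut kappa n n + kmut kappa m m.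
suff : kmut kappa m n <= B0.
  by move=> /le_lt_trans; apply; exact: lte_add_pinfty.
have S0 B : S B set0.
  by split; [exact: compact0|split; [exact: sub0set|exists 0%N; exact: sub0set]].
apply: (@le_trans _ _ (l setT)); last first.
  apply: ge_ereal_sup => _ [K [cK [_ [j KE]]] <-].
  have mK := compact_borel hX cK.
  have en_K : en (mres m mK) by apply: en_le en_m => B mB; exact: mres_le.
  rewrite -(integral_mres m mK f) -[leLHS]/(kmut kappa (mres m mK) n).
  rewrite kmutC//; last exact: en_K.1.
  (* The bound [h * j] on the potential serves to make the mutual energy finite; positive
     definiteness then yields a bound independent of [K] and [j]. *)
  apply: (@le_trans _ _ (kmut kappa n n + kmut kappa (mres m mK) (mres m mK))).
    apply: kmut_pair_le => //.
    apply: (@le_lt_trans _ _ (\int[n]_x (h * j%:R)%:E)).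
      apply: ge0_le_integral => //.
      - by move=> x _; exact: kpot_ge0.
      - by apply: kpot_measurable => //; exact: en_K.1.
      - by move=> x _; apply: kpot_res_bounded.
    rewrite (@integral_cst _ _ _ n setT measurableT).
    have [nT _ _] := fn.
    by rewrite -(fineK (finite_measure_fin_num nT measurableT)) -EFinM ltry.
  by apply: leeD2l; apply: kmut_le => // B mB; exact: mres_le.
apply: integral_le_superadditive => //.
- move=> B mB; apply: ereal_sup_ubound; exists set0 => //.
  by rewrite integral_set0.
- move=> A B mA mB AB; apply: ereal_sup_addP.
  + by eexists; exists set0.
  + by eexists; exists set0.
  + by move=> _ [K _ <-]; exact: integral_ge0.
  + by move=> _ [K _ <-]; exact: integral_ge0.
  move=> _ _ [K [cK [KA [i Ki]]] <-] [L [cL [LB [j Lj]]] <-].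
  apply: ereal_sup_ubound; exists (K `|` L).
    split; first exact: compactU.
    split; first exact: setUSS.
    exists (maxn i j); rewrite subUset; split.
      by apply: (subset_trans Ki); apply: ndE; exact: leq_maxl.
    by apply: (subset_trans Lj); apply: ndE; exact: leq_maxr.
  rewrite ge0_integral_setU//.
  + exact: compact_borel.
  + exact: compact_borel.
  + exact: measurable_funTS mf.
  + rewrite disj_set2E; apply/eqP/seteqP; split => // x [Kx Lx].
    move: AB; rewrite disj_set2E => /eqP <-.
    by split; [exact: KA|exact: LB].
move=> c B c0 mB Bc.
have cE j : c%:E * m (B `&` E j) <= l B.
  apply: (@le_trans _ _ (l (B `&` E j))); last first.
    apply: ereal_sup_le => _ [K [cK [KB jK]] <-]; exists K => //.
    by split=> //; split => //; move=> x /KB[].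
  apply: compact_approx_le => //; first exact: measurableI.
  move=> K cK KB; have mK := compact_borel hX cK.
  apply: (@le_trans _ _ (\int[m]_(x in K) f x)).
    rewrite -(integral_cst m mK); apply: ge0_le_integral => //.
    - by move=> x _; rewrite lee_fin ltW.
    - exact: measurable_funTS mf.
    - by move=> x Kx; apply: ltW; apply: Bc; have [] := KB _ Kx.
  apply: ereal_sup_ubound; exists K => //; split => //; split => //.
  by exists j => x /KB[].
(* Finite energy makes the potential of [m] integrable for [m], hence finite almost everywhere, so
   the sets [E j] cover [B] up to a null set. *)
have mBE : m B = m (\bigcup_j (B `&` E j)).
  have mU : measurable (\bigcup_j (B `&` E j)).
    by apply: bigcup_measurable => j _; exact: measurableI.
  have sub : \bigcup_j (B `&` E j) `<=` B by move=> x [j _ []].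
  rewrite -[in LHS](setDUK sub) measureU//; last 2 first.
  - exact: measurableD.
  - by rewrite setDIK.
  rewrite [X in _ + X](_ : _ = 0) ?adde0//.
  have im : m.-integrable setT (fun x => kpot kappa x m).
    apply/integrableP; split; first exact: kpot_measurable.
    under eq_integral do rewrite gee0_abs ?kpot_ge0//.
    exact: mm.
  have [N [mN mN0 Nsub]] := integrable_ae measurableT im.
  apply: (subset_measure0 _ _ _ mN0) => //; first exact: measurableD.
  move=> x [Bx nU]; apply: Nsub => /= /(_ Logic.I) kf; apply: nU.
  exists (Num.truncn (fine (kpot kappa x m))).+1 => //; split => //=.
  by rewrite /E /= -(fineK kf) lee_fin ltW// truncnS_gt.
rewrite mBE.
have cv : c%:E * m (B `&` E j) @[j --> \oo] --> c%:E * m (\bigcup_j (B `&` E j)).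
  apply: cvgeZl => //; apply: nondecreasing_cvg_mu.
  - by move=> j; exact: measurableI.
  - by apply: bigcup_measurable => j _; exact: measurableI.
  - by move=> i j ij; apply/subsetPset; apply: setIS; exact: ndE.
rewrite -(cvg_lim _ cv)//; apply: lime_le; first by apply/cvg_ex; eexists; exact: cv.
exact: nearW.
Qed.

Lemma en_plus m n : en m -> en n -> en (mplus m n).
Proof.
move=> em en_n; have [fm mm] := em; have [fn nn] := en_n.
have fmn := finite_radon_add hX fm fn.
split => //; rewrite kmut_plusl// kmutC// [X in _ + X]kmutC// !kmut_plusl//.
by apply: lte_add_pinfty; apply: lte_add_pinfty; apply: kmut_lty.
Qed.

Lemma en_mul t m : (0 <= t)%R -> en m -> en (mmul t m).
Proof.
move=> t0 em; have [fm mm] := em; have fmn := finite_radon_mul hX t0 fm.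
split => //; rewrite kmut_mull// kmutC// kmut_mull//.
apply: lte_mul_pinfty; rewrite ?lee_fin//.
by apply: lte_mul_pinfty; rewrite ?lee_fin.
Qed.

(** * The inner product on differences of measures *)

Definition energy m n := fine (kmut kappa m n).

Lemma energyE m n : en m -> en n -> kmut kappa m n = (energy m n)%:E.
Proof.
move=> em en_n; rewrite fineK// ge0_fin_numE; first exact: kmut_lty.
exact: kmut_ge0.
Qed.

Lemma energy_ge0 m n : (0 <= energy m n)%R.
Proof. by rewrite fine_ge0 ?kmut_ge0. Qed.

Lemma energyC m n : en m -> en n -> energy m n = energy n m.
Proof. by move=> [fm _] [fn _]; rewrite /energy kmutC. Qed.

Lemma energy_plusl m n p : en m -> en n -> en p ->
  energy (mplus m n) p = (energy m p + energy n p)%R.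
Proof.
move=> em en_n ep; rewrite {1}/energy kmut_plusl; last exact: ep.1.
by rewrite (energyE em ep) (energyE en_n ep).
Qed.

Lemma energy_plusr m n p : en m -> en n -> en p ->
  energy p (mplus m n) = (energy p m + energy p n)%R.
Proof.
move=> em en_n ep; rewrite energyC//; last exact: en_plus.
by rewrite energy_plusl// (energyC em)// (energyC en_n).
Qed.

Lemma energy_mull t m p : (0 <= t)%R -> en m -> en p -> energy (mmul t m) p = (t * energy m p)%R.
Proof.
move=> t0 em ep; rewrite {1}/energy kmut_mull//; last exact: ep.1.
by rewrite (energyE em ep).
Qed.

Lemma energy_mulr t m p : (0 <= t)%R -> en m -> en p -> energy p (mmul t m) = (t * energy p m)%R.
Proof.
move=> t0 em ep; rewrite energyC//; last exact: en_mul.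
by rewrite energy_mull// (energyC em).
Qed.

Lemma energy_le m n p q : en n -> en q ->
  (forall B, measurable B -> m B <= n B) -> (forall B, measurable B -> p B <= q B) ->
  (energy m p <= energy n q)%R.
Proof.
move=> en_n eq mn pq; have em := en_le mn en_n; have ep := en_le pq eq.
rewrite -lee_fin -!energyE//; apply: kmut_le => //; [exact: en_n.1|exact: eq.1].
Qed.

(* [nrm2 p n] is the squared norm of [p - n], and [ip p n q1 q2] below is the
   inner product of [p - n] and [q1 - q2]. *)
Definition nrm2 p n : R := (energy p p - 2 * energy p n + energy n n)%R.

Definition ip p n q1 q2 : R := (energy p q1 - energy p q2 - energy n q1 + energy n q2)%R.

Lemma kbilE p n q1 q2 : en p -> en n -> en q1 -> en q2 ->
  kbil kappa p n q1 q2 = (ip p n q1 q2)%:E.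
Proof. by move=> ep en_n e1 e2; rewrite /kbil !energyE// -!EFinB -EFinD. Qed.

Lemma nrm2_ip p n : en p -> en n -> nrm2 p n = ip p n p n.
Proof. by move=> ep en_n; rewrite /nrm2 /ip (energyC en_n ep); lra. Qed.

Lemma nrm2_ge0 p n : en p -> en n -> (0 <= nrm2 p n)%R.
Proof.
move=> ep en_n; rewrite nrm2_ip// -lee_fin -kbilE//.
have [|//] := @hka p n; split; [exact: en_finite_energy..|exact: kmut_lty].
Qed.

(** Cauchy-Schwarz without square roots: the squared norms of [(p - n) + t (q1 - q2)] and of
    [(p - n) - t (q1 - q2)] are both nonnegative. *)
Lemma ip_amgm t p n q1 q2 : (0 <= t)%R -> en p -> en n -> en q1 -> en q2 ->
  (2 * t * `|ip p n q1 q2| <= nrm2 p n + t ^+ 2 * nrm2 q1 q2)%R.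
Proof.
move=> t0 ep en_n e1 e2.
have e1' := en_mul t0 e1; have e2' := en_mul t0 e2.
have := nrm2_ge0 (en_plus ep e1') (en_plus en_n e2').
have := nrm2_ge0 (en_plus ep e2') (en_plus en_n e1').
have E1 := en_plus ep e1'; have E2 := en_plus ep e2'.
have E3 := en_plus en_n e1'; have E4 := en_plus en_n e2'.
rewrite /nrm2 /ip !(energy_plusl, energy_plusr, energy_mull, energy_mulr)//.
rewrite (energyC e1 ep) (energyC e2 ep) (energyC e1 en_n) (energyC e2 en_n) (energyC e2 e1).
set b := (X in `|X|%R); move=> H1 H2.
have b2 (c : R) : (2 * t * c <= nrm2 p n + t ^+ 2 * nrm2 q1 q2)%R ->
    (2 * t * - c <= nrm2 p n + t ^+ 2 * nrm2 q1 q2)%R ->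
    (2 * t * `|c| <= nrm2 p n + t ^+ 2 * nrm2 q1 q2)%R.
  by move=> *; have [c0|c0] := leP 0%R c; [rewrite ger0_norm|rewrite ltr0_norm].
by apply: b2; rewrite /b /nrm2; lra.
Qed.

End energy_form.

(* Arithmetic tactics compare atoms up to conversion, which unfolds the
   measures; abstracting the energies first avoids this. *)
Ltac gen_energy := repeat match goal with
  |- context [energy ?k ?x ?y] => let r := fresh "r" in generalize (energy k x y) => r
  end.
(** * Weak convergence of bounded vaguely convergent nets *)

Section weak_convergence.
Context {R : realType} {X : ptopologicalType}.
Variables (kappa : X -> X -> \bar R) (h : R).
Hypothesis hX : hausdorff_space X.
Hypothesis hk : kernel_basic kappa.
Hypothesis hka : strictly_pos_def kappa.
Hypothesis hke : gen_max_principle kappa h.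
Hypothesis hkb : consistent kappa.
Implicit Types (m n p q mu nu : mea R X).
Local Notation en := (en kappa).
Local Notation energy := (energy kappa).
Local Notation ip := (ip kappa).
Local Notation nrm2 := (nrm2 kappa).
Let enP m n := @en_plus R X kappa h hX hk hka hke m n.
Let enM t m := @en_mul R X kappa hX hk t m.
Let energyPl m n p := @energy_plusl R X kappa h hX hk hka hke m n p.
Let energyMl t m p := @energy_mull R X kappa h hX hk hka hke t m p.
Let energyS m n := @energyC R X kappa hX hk m n.

Lemma continuous_borel (f : X -> R) : continuous f ->
  measurable_fun [set: borelT X] (f : borelT X -> R).
Proof.
move=> cf; apply/measurable_EFinP; apply: lsc_measurable.
apply/lower_semicontinuousP => a.
rewrite (_ : [set x | _] = f @^-1` [set y | (a < y)%R]); last first.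
  by apply/seteqP; split => x /=; rewrite lte_fin.
by apply: open_comp; [move=> x _; exact: cf|exact: open_gt].
Qed.

Lemma Cc_bounded (f : X -> R) : Cc f -> exists2 M : R, (0 < M)%R &
  forall x, (`|f x| <= M)%R.
Proof.
move=> [cf cK].
have /compact_bounded : compact (f @` closure [set x | f x != 0%R]).
  by apply: continuous_compact => //; apply: continuous_subspaceT => x; exact: cf.
move=> /ex_strict_bound_gt0[M M0 HM]; exists M => // x.
have [->|fx] := eqVneq (f x) 0%R; first by rewrite normr0 ltW.
by apply: ltW; apply: HM; exists x => //; exact: subset_closure.
Qed.

Lemma Cc_integrable m (f : X -> R) : m setT < +oo -> Cc f ->
  m.-integrable setT (EFin \o f).
Proof.
move=> mT cf; have [M M0 fM] := Cc_bounded cf.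
apply: measurable_bounded_integrable => //.
  by apply: continuous_borel; exact: cf.1.
exists M; split; first exact: num_real.
by move=> y My x _; apply: le_trans (fM x) _; exact: ltW.
Qed.

Lemma mint_fin m (f : X -> R) : m setT < +oo -> Cc f -> mint m f \is a fin_num.
Proof. by move=> mT cf; apply: integrable_fin_num => //; exact: Cc_integrable. Qed.

Lemma mint_eq (mu nu : pmeas R X) f : meas_eq mu nu -> mint mu f = mint nu f.
Proof. by move=> e; exact: eq_pmeas_integral. Qed.

Definition mid m n := mplus (mmul 2^-1 m) (mmul 2^-1 n).

Lemma en_mid m n : en m -> en n -> en (mid m n).
Proof. by move=> em en_n; apply: enP; apply: enM. Qed.

Lemma mint_mid m n f : m setT < +oo -> n setT < +oo -> Cc f ->
  fine (mint (mid m n) f) = (2^-1 * (fine (mint m f) + fine (mint n f)))%R.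
Proof.
move=> mT nT cf.
have h0 : (0 <= 2^-1 :> R)%R by [].
have mf : measurable_fun [set: borelT X] (EFin \o f).
  by apply/measurable_EFinP; apply: continuous_borel; exact: cf.1.
have mfp := measurable_funepos mf; have mfn := measurable_funeneg mf.
have fp (m' : mea R X) : m' setT < +oo -> \int[m']_x (EFin \o f)^\+ x \is a fin_num.
  move=> fm'; apply: (integrable_pos_fin_num measurableT).
  exact: Cc_integrable.
have fn (m' : mea R X) : m' setT < +oo -> \int[m']_x (EFin \o f)^\- x \is a fin_num.
  move=> fm'; apply: (integrable_neg_fin_num measurableT).
  exact: Cc_integrable.
have IE (m' : mea R X) : mint m' f =
    \int[m']_x (EFin \o f)^\+ x - \int[m']_x (EFin \o f)^\- x.
  by rewrite /mint integralE.
rewrite !IE !integral_mplus ?integral_mmul//.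
move: (fp _ mT) (fp _ nT) (fn _ mT) (fn _ nT).
move: (\int[m]_x _^\+ x) (\int[n]_x _^\+ x) (\int[m]_x _^\- x) (\int[n]_x _^\- x).
by move=> [r1||] // [r2||] // [r3||] // [r4||] // _ _ _ _ /=; lra.
Qed.

Lemma kbil_ext (p n q1 q2 p' n' q1' q2' : pmeas R X) :
  meas_eq p p' -> meas_eq n n' -> meas_eq q1 q1' -> meas_eq q2 q2' ->
  kbil kappa p n q1 q2 = kbil kappa p' n' q1' q2'.
Proof.
move=> e1 e2 e3 e4.
by rewrite /kbil (eq_kmut _ e1 e3) (eq_kmut _ e1 e4) (eq_kmut _ e2 e3) (eq_kmut _ e2 e4).
Qed.

Lemma dist2_0E m n : en m -> en n ->
  dist2 kappa m (fun _ => 0) n (fun _ => 0) = (nrm2 m n)%:E.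
Proof.
move=> em en_n; rewrite /dist2 (nrm2_ip hX hk)// -(kbilE hX hk hka hke)//.
by apply: kbil_ext => B mB; rewrite /madd ?adde0 ?add0e.
Qed.

Lemma dist2E p n p' n' : en p -> en n -> en p' -> en n' ->
  dist2 kappa p n p' n' = (nrm2 (mplus p n') (mplus n p'))%:E.
Proof.
move=> ep en_n ep' en'; rewrite /dist2.
have e1 := enP ep en'; have e2 := enP en_n ep'.
rewrite (nrm2_ip hX hk)// -(kbilE hX hk hka hke)//.
by apply: kbil_ext => B mB; rewrite /madd mplusE.
Qed.

Lemma ip_sym p n q1 q2 : en p -> en n -> en q1 -> en q2 ->
  ip p n q1 q2 = ip q1 q2 p n.
Proof.
move=> ep en_n e1 e2; rewrite /ip (energyS e1 ep) (energyS e1 en_n) (energyS e2 ep) (energyS e2 en_n).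
by lra.
Qed.

(** Continuity of the inner product, uniform on norm balls: for [t = e / (C + 1)] the quadratic term
    in [ip_amgm] is at most [t * e], so [d = t * e] works. *)
Lemma ip_small (C e : R) : (0 <= C)%R -> (0 < e)%R -> exists2 d : R, (0 < d)%R &
  forall p n q1 q2, en p -> en n -> en q1 -> en q2 ->
    (nrm2 p n < d)%R -> (nrm2 q1 q2 <= C)%R -> (`|ip p n q1 q2| < e)%R.
Proof.
move=> C0 e0; have C1 : (0 < C + 1)%R by rewrite ltr_wpDl.
pose t := (e / (C + 1))%R; have t0 : (0 < t)%R by rewrite divr_gt0.
exists (t * e)%R; first by rewrite mulr_gt0.
move=> p n q1 q2 ep en_n e1 e2 pn qC.
have := ip_amgm hX hk hka hke (ltW t0) ep en_n e1 e2.
set b := (`|_|)%R; move=> H.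
have tC : (t * (C + 1) = e)%R by rewrite /t mulfVK// gt_eqF.
have H2 : (t ^+ 2 * nrm2 q1 q2 <= t * e)%R.
  rewrite expr2 -mulrA ler_pM2l// -tC ler_pM2l//.
  by apply: (le_trans qC); rewrite lerDl.
have : (2 * t * b < 2 * t * e)%R by lra.
by rewrite ltr_pM2l// mulr_gt0.
Qed.

Section nets.
Variables (D : Type) (le : D -> D -> Prop) (nus : D -> mea R X) (nu : mea R X).
Hypothesis dirD : directed le.
Hypothesis en_nus : forall s, en (nus s).
Hypothesis en_nu : en nu.
Variable C : R.
Hypothesis bnd : exists s0, forall s, le s0 s -> (energy (nus s) (nus s) <= C)%R.
Hypothesis vag : vague_conv le nus nu.

(** Midpoints in place of all convex combinations: they are what the parallelogram identity uses,
    and properties pass to the hull by a two-case induction. *)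
Inductive hull (Q : D -> Prop) : mea R X -> Prop :=
| hull_base t : Q t -> hull Q (nus t)
| hull_mid m n : hull Q m -> hull Q n -> hull Q (mid m n).

Lemma hull_en Q m : hull Q m -> en m.
Proof. by elim=> [t _|m1 m2 _ e1 _ e2]; [exact: en_nus|exact: en_mid]. Qed.

Lemma hullS (Q Q' : D -> Prop) m : (forall t, Q t -> Q' t) -> hull Q m -> hull Q' m.
Proof.
by move=> QQ'; elim=> [t /QQ'|m1 m2 _ e1 _ e2]; [exact: hull_base|exact: hull_mid].
Qed.

Lemma energy_midl m n p : en m -> en n -> en p ->
  energy (mid m n) p = (2^-1 * (energy m p + energy n p))%R.
Proof.
have h0 : (0 <= 2^-1 :> R)%R by [].
move=> em en_n ep; have em' := enM h0 em; have en' := enM h0 en_n.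
by rewrite /mid energyPl// !energyMl// mulrDr.
Qed.

Lemma energy_midr m n p : en m -> en n -> en p ->
  energy p (mid m n) = (2^-1 * (energy p m + energy p n))%R.
Proof.
move=> em en_n ep; rewrite energyS//; last exact: en_mid.
by rewrite energy_midl// (energyS em)// (energyS en_n).
Qed.

Lemma parallelogram m n : en m -> en n ->
  nrm2 m n = (2 * energy m m + 2 * energy n n - 4 * energy (mid m n) (mid m n))%R.
Proof.
move=> em en_n; have emn := en_mid em en_n.
rewrite /nrm2 energy_midl// !energy_midr// (energyS en_n em).
by lra.
Qed.

(* Minimal-norm elements of the tails' midpoint hulls form a strongly Cauchy
   net that still converges vaguely to [nu]; consistency makes it converge
   strongly, which excludes a persistent gap in the pairing. *)
Lemma weak_conv_lt p n (e : R) : en p -> en n -> (0 < e)%R ->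
  exists s0, forall s, le s0 s -> (ip p n (nus s) nu < e)%R.
Proof.
move=> ep en_n e0; apply: contrapT => nex.
have [[d0 _] lexx letr leub] := dirD.
have [sC HC] := bnd.
(* If the claim fails, every tail contains indices with pairing at least [e]. This condition is
   affine in the measure, so it survives in the hull of these indices. *)
pose Q s t := [/\ le s t, (e <= ip p n (nus t) nu)%R & (energy (nus t) (nus t) <= C)%R].
have Qex s : exists t, Q s t.
  apply: contrapT => nt; apply: nex; have [u [su sCu]] := leub s sC.
  exists u => t ut; rewrite ltNge; apply/negP => et; apply: nt; exists t.
  by split=> //; [exact: letr ut|apply: HC; exact: letr ut].
have QS s s' t : le s s' -> Q s' t -> Q s t.
  by move=> ss' [st et Ct]; split => //; exact: letr st.
have hull_ip s m : hull (Q s) m -> (e <= ip p n m nu)%R.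
  elim=> [t []//|m1 m2 /hull_en e1 h1 /hull_en e2 h2].
  by move: h1 h2; rewrite /ip !energy_midr//; lra.
pose E s := [set energy m m | m in hull (Q s)].
have E0 s : E s !=set0 by have [t Qt] := Qex s; eexists; exists (nus t) => //; exact: hull_base.
have lbE s : lbound (E s) 0%R by move=> _ [m _ <-]; exact: energy_ge0.
have hinf s : has_inf (E s) by split => //; exists 0%R.
pose d s := inf (E s).
have dle s m : hull (Q s) m -> (d s <= energy m m)%R.
  by move=> hm; apply: ge_inf; [exists 0%R|exists m].
have dC s : (d s <= C)%R.
  have [t Qt] := Qex s; apply: le_trans (dle s (nus t) _) _; first exact: hull_base.
  by case: Qt.
have dmono s s' : le s s' -> (d s <= d s')%R.
  move=> ss'; apply: lb_le_inf => // _ [m hm <-]; apply: dle.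
  by apply: hullS hm => t; exact: QS.
have hsup : has_sup (range d).
  by split; [exists (d d0), d0|exists C => _ [s _ <-]].
pose dd := sup (range d).
have ddub s : (d s <= dd)%R by apply: ub_le_sup; [case: hsup|exists s].
(* The second index is the tolerance [1 / (k + 1)] up to which the infimum of the energy over a hull
   is attained. *)
have pick (s : D * nat) : exists m, hull (Q s.1) m /\ (energy m m < d s.1 + (s.2.+1)%:R^-1)%R.
  have e1 : (0 < (s.2.+1)%:R^-1 :> R)%R by rewrite invr_gt0.
  have [_ [m hm <-] lt] := inf_adherent e1 (hinf s.1).
  by exists m.
have [nn Hnn] := choice pick.
pose le' (x y : D * nat) := le x.1 y.1 /\ (x.2 <= y.2)%N.
have en_nn x : en (nn x) by apply: hull_en; exact: (Hnn x).1.
have dir' : directed le'.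
  split.
  - by exists (d0, 0%N).
  - by move=> x; split.
  - by move=> x y z [a1 a2] [b1 b2]; split; [exact: letr b1|exact: leq_trans b2].
  - move=> x y; have [u [xu yu]] := leub x.1 y.1; exists (u, maxn x.2 y.2).
    by split; split => //=; rewrite ?leq_maxl ?leq_maxr.
have fin_en x : finite_energy kappa (nn x) by exact: en_finite_energy.
have cau : strong_cauchy kappa le' nn.
  (* Both energies are below [dd + e'/8], and the midpoint, lying in the hull of the same tail, has
     energy above [dd - e'/8]; the parallelogram identity then bounds the squared distance by
     [e']. *)
  move=> e' e'0; have e8 : (0 < e' / 8)%R by rewrite divr_gt0.
  have [_ [s0 _ <-] ds0] := sup_adherent e8 hsup.
  pose j0 := Num.truncn (e' / 8)^-1.
  have j0P j : (j0 <= j)%N -> (j.+1%:R^-1 < e' / 8)%R.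
    move=> jj; rewrite invf_plt ?posrE//.
    apply: lt_le_trans (truncnS_gt _) _.
    by rewrite ler_nat.
  exists (s0, j0) => x y [/= sx jx] [/= sy jy].
  have hx : hull (Q s0) (nn x) by apply: hullS (Hnn x).1 => t; exact: QS.
  have hy : hull (Q s0) (nn y) by apply: hullS (Hnn y).1 => t; exact: QS.
  rewrite dist2_0E// parallelogram// lte_fin.
  have := dle _ _ (hull_mid hx hy).
  have kd z : (j0 <= z.2)%N -> (energy (nn z) (nn z) < dd + e' / 8)%R.
    move=> jz; apply: lt_le_trans (Hnn z).2 _; apply: lerD => //.
    by apply: ltW; exact: j0P.
  have := kd x jx; have := kd y jy; move: ds0; rewrite -/dd.
  by lra.
(* A vague neighborhood given by one test function is convex, so the hull of a tail stays in it. *)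
have vagh s m f (e' : R) : hull (Q s) m -> Cc f ->
    (forall t, le s t -> `|mint (nus t) f - mint nu f| < e'%:E) ->
    `|mint m f - mint nu f| < e'%:E.
  move=> hm cf Hs.
  have fnu : mint nu f \is a fin_num by apply: mint_fin => //; case: en_nu.1.
  have fm' m' : en m' -> mint m' f \is a fin_num.
    by move=> em'; apply: mint_fin => //; case: em'.1.
  have rw m' : en m' -> (`|mint m' f - mint nu f| < e'%:E) =
      (`|fine (mint m' f) - fine (mint nu f)| < e')%R.
    by move=> em'; rewrite -{1}(fineK (fm' _ em')) -{1}(fineK fnu).
  elim: hm => [t [st _ _]|m1 m2 h1 ih1 h2 ih2]; first exact: Hs.
  have e1 := hull_en h1; have e2 := hull_en h2.
  move: ih1 ih2; rewrite !rw//; last exact: en_mid.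
  rewrite mint_mid//; [|by case: e1.1|by case: e2.1].
  by rewrite !ltr_norml => /andP[? ?] /andP[? ?]; apply/andP; split; lra.
have clu : vague_cluster le' nn nu.
  move=> fs fsC e' e'0 [s j].
  have [s1 [ss1 Hs1]] : exists s1, le s s1 /\ forall f, f \in fs -> forall t, le s1 t ->
      `|mint (nus t) f - mint nu f| < e'%:E.
    elim: fs fsC => [|f fs ih] fsC; first by exists s; split.
    have [|s1 [ss1 H1]] := ih; first by move=> g gfs; apply: fsC; rewrite inE gfs orbT.
    have [s2 H2] := vag (fsC f (mem_head _ _)) e'0.
    have [s3 [s13 s23]] := leub s1 s2; exists s3; split; first exact: letr s13.
    move=> g; rewrite inE => /orP[/eqP ->|gfs] t s3t.
      by apply: H2; exact: letr s3t.
    by apply: H1 => //; exact: letr s3t.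
  exists (s1, j); split => // f ffs.
  by apply: (vagh s1) => //; [exact: (Hnn (s1, j)).1|exact: fsC|exact: Hs1].
have [_ strong] := hkb dir' fin_en cau (finite_radon_radon hX en_nu.1) clu.
have [dl dl0 Hdl] := ip_small (nrm2_ge0 hX hk hka hke ep en_n) e0.
have [x0 Hx0] := strong _ dl0.
have := Hx0 x0; rewrite dist2_0E// lte_fin => /(_ (conj (lexx _) (leqnn _))) lt.
have := Hdl _ _ _ _ (en_nn x0) en_nu ep en_n lt (Order.POrderTheory.lexx _).
rewrite -ip_sym// => /ltr_normlW.
by rewrite ltNge (hull_ip _ _ (Hnn x0).1).
Qed.

(** Exchanging [p] and [n] negates the pairing, so the one-sided statement gives both bounds. *)
Lemma weak_conv p n (e : R) : en p -> en n -> (0 < e)%R ->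
  exists s0, forall s, le s0 s -> (`|ip p n (nus s) nu| < e)%R.
Proof.
move=> ep en_n e0; have [_ _ letr leub] := dirD.
have [s1 H1] := weak_conv_lt ep en_n e0.
have [s2 H2] := weak_conv_lt en_n ep e0.
have [s3 [s13 s23]] := leub s1 s2; exists s3 => s s3s.
have := H1 s (letr _ _ _ s13 s3s); have := H2 s (letr _ _ _ s23 s3s).
by rewrite /ip ltr_norml => ? ?; apply/andP; split; lra.
Qed.

End nets.
End weak_convergence.

(** * Cut-off functions and the mass of vague limits *)

Lemma urysohn_Cc (R : realType) (X : ptopologicalType) (K : set X) :
  hausdorff_space X -> locally_compact [set: X] -> compact K ->
  exists f : X -> R, [/\ Cc f, (forall x, 0 <= f x <= 1)%R & forall x, K x -> f x = 1%R].
Proof.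
move=> hX lcX cK; pose Y := one_point_compactification X.
have hY : hausdorff_space Y by exact: one_point_compactification_hausdorff.
have cY : compact [set: Y] by exact: one_point_compactification_compact.
have nY := compact_normal hY cY.
have cN : closed [set None : Y].
  by apply: accessible_closed_set1; exact: hausdorff_accessible.
have csK : closed (Some @` K : set Y).
  apply: (compact_closed hY); apply: continuous_compact => //.
  apply: continuous_subspaceT.
  exact: one_point_compactification_some_continuous.
have sep : uniform_separator [set None : Y] (Some @` K : set Y).
  apply: (normal_uniform_separator nY) => //.
  by apply/seteqP; split => // x [/= -> []].
have [f [cf f01 fN fK]] := (uniform_separatorP (R := R) _ _).1 sep.
pose u x : R := f (Some x : Y).
have cu : continuous u.
  move=> x; apply: (@continuous_comp _ _ _ (Some : X -> Y) f).
    exact: one_point_compactification_some_continuous.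
  exact: cf.
have u01 x : (0 <= u x <= 1)%R.
  by have : `[0%R, 1%R]%classic (u x) by apply: f01; exists (Some x : Y).
(* The function [u] merely tends to 0 at infinity. Truncation at level [1/2] puts the support inside
   [u >= 1/2], which misses a neighborhood of the point at infinity and hence lies in a compact
   set. *)
pose v x : R := Num.max 0%R (2 * u x - 1)%R.
exists v; split.
- split.
    move=> x; apply: (@continuous_max _ _ (fun=> 0%R) (fun x => 2 * u x - 1)%R x).
      exact: cst_continuous.
    apply: continuousB; last exact: cst_continuous.
    by apply: continuousM; [exact: cst_continuous|exact: cu].
  have : @nbhs _ Y None (f @^-1` [set r | (r < 2^-1)%R]).
    apply: open_nbhs_nbhs; split.
      by apply: open_comp; [move=> x _; exact: cf|exact: open_lt].
    have : [set 0%R] (f None) by apply: fN; exists None.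
    by move=> /= ->; rewrite invr_gt0.
  move=> [U [cU clU]] HU; apply: (subclosed_compact _ cU); first exact: closed_closure.
  apply: (@subset_trans _ [set x | (2^-1 <= u x)%R]); last first.
    move=> x /= ux; apply: contrapT => nUx.
    have : (f @^-1` [set r | (r < 2^-1)%R]) (Some x : Y) by apply: HU; left; exists x.
    by rewrite /= ltNge ux.
  have clo : closed [set x | (2^-1 <= u x)%R].
    apply: (@closed_comp _ _ u [set r | (2^-1 <= r)%R]); last exact: closed_ge.
    by move=> x _; exact: cu.
  rewrite [X in _ `<=` X](closure_id _).1//; apply: closureS => x /=.
  apply: contraNT; rewrite -ltNge => ux; apply/eqP/max_idPl; lra.
- move=> x; rewrite /v le_max lexx /= ge_max ler01 /=.
  by have /andP[? ?] := u01 x; lra.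
- move=> x Kx; have : [set 1%R] (u x) by apply: fK; exists (Some x : Y) => //; exists x.
  by rewrite /v /= => ->; rewrite max_r; lra.
Qed.

(** Mass can escape to infinity but cannot appear: by inner regularity it is enough to bound [nu K]
    for compact [K], and a cut-off function equal to 1 on [K] compares it with the masses along the
    net. *)
Lemma vague_mass_le (R : realType) (X : ptopologicalType) (D : Type)
    (le : D -> D -> Prop) (nus : D -> mea R X) (nu : mea R X) (M : R) :
  hausdorff_space X -> locally_compact [set: X] -> directed le ->
  (forall s, nus s setT <= M%:E) -> radon nu -> vague_conv le nus nu ->
  nu setT <= M%:E.
Proof.
move=> hX lcX [_ lexx _ _] bM [_ [_ _ inn]] vag; rewrite inn; last exact: openT.
apply: ge_ereal_sup => _ [K [cK _] <-].
have mK := compact_borel hX cK.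
have [f [cf f01 fK]] := @urysohn_Cc R X K hX lcX cK.
have mf : measurable_fun [set: borelT X] (EFin \o f : borelT X -> \bar R).
  by apply/measurable_EFinP; apply: continuous_borel; exact: cf.1.
have f0 x : 0 <= (f x)%:E by have /andP[+ _] := f01 x; rewrite lee_fin.
apply/lee_addgt0Pr => e e0; have [s0 /(_ _ (lexx s0)) Hs] := vag f cf e e0.
have mint_le : mint (nus s0) f <= M%:E.
  apply: le_trans (bM s0); rewrite -[leRHS]mul1e -(integral_cst (nus s0) measurableT).
  apply: ge0_le_integral => // x _.
  by have /andP[_ +] := f01 x; rewrite lee_fin.
have mint_ge : nu K <= mint nu f.
  rewrite -[leLHS]mul1e -(integral_cst nu mK).
  apply: (@le_trans _ _ (\int[nu]_(x in K) (f x)%:E)).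
    apply: ge0_le_integral => //.
    - exact: measurable_funTS mf.
    - by move=> x Kx; rewrite lee_fin fK.
  by apply: ge0_subset_integral.
apply: (le_trans mint_ge).
have m1 : 0 <= mint (nus s0) f by exact: integral_ge0.
have m2 : 0 <= mint nu f by exact: integral_ge0.
move: mint_le Hs m1 m2.
case: (mint (nus s0) f) => [r||] //; case: (mint nu f) => [r'||] //.
rewrite -EFinB abse_EFin -EFinD !lte_fin !lee_fin ltr_norml => rM /andP[? ?] _ _.
by lra.
Qed.

(** * Countable sums of measures *)

Section countable_sum.
Context {R : realType} {X : ptopologicalType} {I : countType}.
Implicit Types (P : pred I) (ms : I -> mea R X).

Lemma series_pickle P (F : I -> \bar R) : (forall i, 0 <= F i) ->
  \sum_(k <oo) (if pickle_inv k is Some i then (if P i then F i else 0) else 0) =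
  \esum_(i in [set i | P i]) F i.
Proof.
move=> F0; pose a (k : nat) : \bar R :=
  if @pickle_inv I k is Some i then (if P i then F i else 0) else 0.
have a0 k : 0 <= a k by rewrite /a; case: pickle_inv => // i; case: ifP.
rewrite -/(\sum_(k <oo) a k) nneseries_esumT//.
transitivity (\esum_(k in pickle @` [set i | P i]) a k); last first.
  rewrite esum_image; last first.
    by move=> i j _ _; exact: (pcan_inj (@pickleK_inv I)).
  by apply: eq_esum => i /= Pi; rewrite /a pickleK_inv Pi.
rewrite [RHS]esum_mkcond; apply: eq_esum => k _.
case: ifPn => // /negP; rewrite inE => nk.
rewrite /a; case E : (pickle_inv k) => [i|] //; case: ifPn => // Pi.
exfalso; apply: nk; exists i => //.
by have := @pickle_invK I k; rewrite /oapp E.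
Qed.

(** Summing along the codes of [I] presents the sum as a series of measures, from which it inherits
    the measure structure; codes of no index contribute the zero measure. *)
Definition msumI P ms : mea R X := mseries (fun k =>
  if @pickle_inv I k is Some i then (if P i then ms i else mzero) else mzero) 0.

Lemma msumIE P ms B : msumI P ms B = \esum_(i in [set i | P i]) ms i B.
Proof.
rewrite -series_pickle// /msumI /mseries; apply: eq_eseriesr => k _.
by case: pickle_inv => // i; case: ifP.
Qed.

Lemma integral_msumI P ms (f : X -> \bar R) : measurable_fun [set: borelT X] f ->
  (forall x, 0 <= f x) ->
  \int[msumI P ms]_x f x = \esum_(i in [set i | P i]) \int[ms i]_x f x.
Proof.
move=> mf f0; rewrite -series_pickle; last by move=> i; exact: integral_ge0.
rewrite /msumI ge0_integral_measure_series//; apply: eq_eseriesr => k _.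
case: pickle_inv => [i|]; last by rewrite integral_measure_zero.
by case: ifP => // _; rewrite integral_measure_zero.
Qed.

Definition mupd ms i (m : mea R X) : I -> mea R X := fun j => if j == i then m else ms j.

(** Written additively, with the removed term on the left, because the values may be infinite. *)
Lemma msumI_upd P ms i m B : msumI P (mupd ms i m) B + (if P i then ms i B else 0) =
  msumI P ms B + (if P i then m B else 0).
Proof.
have eqD (Q : set I) : \esum_(j in Q `&` ~` [set i]) mupd ms i m j B =
    \esum_(j in Q `&` ~` [set i]) ms j B.
  by apply: eq_esum => j [_ /= /eqP ji]; rewrite /mupd (negbTE ji).
rewrite !msumIE (esumID [set i]) // [in RHS](esumID [set i])// eqD.
case: ifPn => Pi; last first.
  by rewrite !adde0; congr (_ + _); rewrite !esum1// => j [/= Pj ji];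
    move: Pi; rewrite -ji Pj.
have -> : [set j | P j] `&` [set i] = [set i].
  by apply/seteqP; split => j; [case|move=> /= ->].
by rewrite !esum_set1// /mupd eqxx addeAC [RHS]addeAC (addeC (m B)).
Qed.

End countable_sum.
(** * Condenser measures *)

Section csum_theory.
Context {R : realType} {I : countType}.
Implicit Types (u v c eta : I -> R).

(** Frees [csum] from positive and negative parts; the decomposition used later follows the signs of
    the plates. *)
Lemma csum_sub u v : (forall i, 0 <= u i)%R -> (forall i, 0 <= v i)%R ->
  \esum_(i in setT) (u i)%:E < +oo -> \esum_(i in setT) (v i)%:E < +oo ->
  csum (fun i => (u i - v i)%:E) =
  \esum_(i in setT) (u i)%:E - \esum_(i in setT) (v i)%:E.
Proof.
move=> u0 v0 su sv.
have sm (w : I -> R) : (forall i, 0 <= w i)%R -> \esum_(i in setT) (w i)%:E < +oo ->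
    summable setT (EFin \o w).
  move=> w0 sw; rewrite /summable (eq_esum (b := fun i => (w i)%:E))//.
  by move=> i _; rewrite /= ger0_norm.
rewrite -(esumB (sm _ u0 su) (sm _ v0 sv))//; last 2 first.
- by move=> i _; rewrite lee_fin.
- by move=> i _; rewrite lee_fin.
by congr (_ - _); apply: eq_esum => i _; rewrite ?funeposE ?funenegE.
Qed.

Lemma csum_fin c (r : R) : csum (fun i => (c i)%:E) = r%:E ->
  \esum_(i in setT) (Num.max (c i) 0)%:E < +oo /\
  \esum_(i in setT) (Num.max (- c i) 0)%:E < +oo.
Proof.
rewrite /csum.
under eq_esum do rewrite -EFin_max.
under [X in _ - X]eq_esum do rewrite -EFinN -EFin_max.
have : 0 <= \esum_(i in setT) (Num.max (c i) 0)%:E.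
  by apply: esum_ge0 => i _; rewrite lee_fin le_max lexx orbT.
have : 0 <= \esum_(i in setT) (Num.max (- c i) 0)%:E.
  by apply: esum_ge0 => i _; rewrite lee_fin le_max lexx orbT.
move: (\esum_(i in setT) (Num.max (c i) 0)%:E) (\esum_(i in setT) (Num.max (- c i) 0)%:E).
by move=> [s||] [t||] // _ _ _; rewrite !ltry.
Qed.

(** The nonnegative differences [c i - eta i] sum to zero. To subtract the two sums, positive and
    negative parts are regrouped so that only finite sums of nonnegative terms occur. *)
Lemma csum_eq_le eta c (r : R) : csum (fun i => (eta i)%:E) = r%:E ->
  csum (fun i => (c i)%:E) = r%:E -> (forall i, eta i <= c i)%R ->
  forall i, eta i = c i.
Proof.
move=> se sc ec i.
have [ep en] := csum_fin se; have [cp cn] := csum_fin sc.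
pose pos (w : I -> R) j := Num.max (w j) 0%R.
pose neg (w : I -> R) j := Num.max (- w j)%R 0%R.
have pos0 w j : (0 <= pos w j)%R by rewrite /pos le_max lexx orbT.
have neg0 w j : (0 <= neg w j)%R by rewrite /neg le_max lexx orbT.
have pn w j : (pos w j - neg w j = w j)%R.
  rewrite /pos /neg; have /orP[w0|w0] := le_total 0%R (w j).
    by rewrite max_l// max_r; lra.
  by rewrite max_r// max_l; lra.
have d0 j : (0 <= c j - eta j)%R by rewrite subr_ge0.
have H1 : csum (fun j => ((pos c j + neg eta j) - (neg c j + pos eta j))%:E) = 0.
  rewrite csum_sub; last 4 first.
  - by move=> j; rewrite addr_ge0.
  - by move=> j; rewrite addr_ge0.
  - under eq_esum do rewrite EFinD.
    by rewrite esumD ?lte_add_pinfty// => j _; rewrite lee_fin.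
  - under eq_esum do rewrite EFinD.
    by rewrite esumD ?lte_add_pinfty// => j _; rewrite lee_fin.
  under eq_esum do rewrite EFinD.
  under [X in _ - X]eq_esum do rewrite EFinD.
  rewrite !esumD; [|by move=> j _; rewrite lee_fin..].
  have E w (s : R) : csum (fun j => (w j)%:E) = s%:E ->
      \esum_(j in setT) (pos w j)%:E - \esum_(j in setT) (neg w j)%:E = s%:E.
    move=> <-; rewrite /csum; congr (_ - _); apply: eq_esum => j _.
      by rewrite -EFin_max.
    by rewrite -EFinN -EFin_max.
  move: (E _ _ se) (E _ _ sc).
  move: (\esum_(j in setT) (pos c j)%:E) (\esum_(j in setT) (neg c j)%:E)
    (\esum_(j in setT) (pos eta j)%:E) (\esum_(j in setT) (neg eta j)%:E).
  move=> [x||] [y||] [z||] [w||] // [e1] [e2].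
  by apply: (congr1 EFin); lra.
have dE j : ((pos c j + neg eta j) - (neg c j + pos eta j))%:E =
    ((c j - eta j) - 0)%:E.
  by congr EFin; rewrite -(pn c j) -(pn eta j); lra.
move: H1; rewrite (funext dE) csum_sub//; last 2 first.
- apply: (@le_lt_trans _ _ (\esum_(j in setT) ((pos c j)%:E + (neg eta j)%:E))).
    apply: le_esum => j _; rewrite -EFinD lee_fin.
    by have := pn c j; have := pn eta j; have := neg0 c j; have := pos0 eta j; lra.
  by rewrite esumD ?lte_add_pinfty// => k _; rewrite lee_fin.
- by rewrite esum1.
rewrite [X in _ - X]esum1// sube0 => sd0.
have : ((c i - eta i)%R)%:E <= \esum_(j in setT) (c j - eta j)%:E.
  by apply: esum_ge; exists [set i]; [split|rewrite fsbig_set1].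
by rewrite sd0 lee_fin => ci; apply/eqP; rewrite eq_le ec /=; move: ci; lra.
Qed.
End csum_theory.

(** * Families of measures on the plates *)

Section condenser_measures.
Context {R : realType} {X : ptopologicalType} {I : countType}.
Variables (kappa : X -> X -> \bar R) (h : R) (alpha : I -> bool) (A : I -> set X).
Variables (chip chin : pmeas R X) (g : X -> R) (a : I -> R).
Hypothesis hX : hausdorff_space X.
Hypothesis hk : kernel_basic kappa.
Hypothesis hka : strictly_pos_def kappa.
Hypothesis hke : gen_max_principle kappa h.
Hypothesis hA : condenser kappa alpha A.
Hypothesis hchi : external_field kappa alpha A chip chin.
Hypothesis hg : constraint_g kappa A g.
Hypothesis ha : constraint_a a.
Implicit Types (m n p q : mea R X) (mu : I -> pmeas R X).
Local Notation en := (en kappa).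
Local Notation energy := (energy kappa).
Local Notation ip := (ip kappa).
Local Notation nrm2 := (nrm2 kappa).
Local Notation gi := (ginf A g).

Lemma A_closed i : closed (A i). Proof. by case: hA => /(_ i)[]. Qed.

Lemma A_borel i : measurable (A i : set (borelT X)).
Proof. by apply: closed_borel; exact: A_closed. Qed.

Lemma bigA_borel (Q : pred I) :
  measurable (\bigcup_(i in [set i | Q i]) A i : set (borelT X)).
Proof.
rewrite bigcup_mkcond; apply: countable_bigcupT_measurable => // j.
by case: ifP => // _; exact: A_borel.
Qed.

Lemma ginf_gt0 : (0 < gi)%R. Proof. by case: hg. Qed.

Lemma ginf_le i x : A i x -> (gi <= g x)%R.
Proof.
(* By convention [inf] is 0 on a set without infimum, which [0 < ginf] rules out. *)
move=> Aix; have hi : has_inf [set g x | x in Aall A].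
  apply: contrapT => /inf_out gi0; have := ginf_gt0.
  by rewrite /ginf gi0 ltxx.
by apply: ge_inf; [case: hi|exists x => //; exists i].
Qed.

(** Nothing is known about [g] off the plates. Extended by 0 it is a nonnegative Borel function with
    the same integral against measures carried by [A i]. *)
Definition gA i : X -> \bar R := (fun x => (g x)%:E) \_ (A i).

Lemma gA_in i x : A i x -> gA i x = (g x)%:E.
Proof. by move=> Aix; rewrite /gA /patch mem_set. Qed.

Lemma gA_ge0 i x : 0 <= gA i x.
Proof.
rewrite /gA /patch; case: ifPn => //; rewrite inE => Aix.
by rewrite lee_fin; apply: le_trans (ginf_le Aix); exact: ltW ginf_gt0.
Qed.

Lemma gA_measurable i : measurable_fun [set: borelT X] (gA i).
Proof.
apply/(measurable_restrictT _ (A_borel i)).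
apply/measurable_EFinP; have [cg _ _] := hg.
have cgi : {within A i, continuous g}.
  by apply: continuous_subspaceW cg => x Aix; exists i.
apply: (measurability _ (RGenOInfty.measurableE R)).
move=> _ [_ [r ->] <-].
have /continuousP/(_ `]r, +oo[%classic) := cgi.
move=> /(_ (interval_open _ _)) /open_subspaceP.
case=> // V oV VA; rewrite setIC -VA.
by apply: measurableI; [exact: open_borel|exact: A_borel].
Qed.

Lemma concentrated_null m i : concentrated m (A i) -> m (~` A i) = 0.
Proof.
move=> [B [mB B0 sB]]; apply: (subset_measure0 _ _ sB B0) => //.
by apply: measurableC; exact: A_borel.
Qed.

Lemma null_concentrated m (B : set (borelT X)) : measurable B -> m (~` B) = 0 ->
  concentrated m B.
Proof. by move=> mB B0; exists (~` B); split => //; exact: measurableC. Qed.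

Lemma mint_gA m i : m (~` A i) = 0 -> mint m g = \int[m]_x gA i x.
Proof.
move=> m0; rewrite /mint (integral_setC_null _ (A_borel i) m0).
by rewrite integral_mkcond.
Qed.

Lemma mass_le_ginf m i (B : \bar R) : m (~` A i) = 0 -> \int[m]_x gA i x <= B ->
  m setT <= (gi^-1)%:E * B.
Proof.
move=> m0 mB; have g0 := ginf_gt0; rewrite muleC lee_pdivlMr//.
apply: le_trans mB; rewrite muleC -(integral_cst m measurableT gi%:E).
rewrite (integral_setC_null _ (A_borel i) m0).
apply: (@le_trans _ _ (\int[m]_(x in A i) gA i x)).
  apply: ge0_le_integral => //.
  - exact: A_borel.
  - by move=> x _; rewrite lee_fin ltW.
  - by apply: measurable_funTS; exact: gA_measurable.
  - by move=> x Aix; rewrite gA_in// lee_fin; exact: ginf_le Aix.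
apply: ge0_subset_integral => //.
- exact: A_borel.
- exact: gA_measurable.
- by move=> x _; exact: gA_ge0.
Qed.

Definition mass_bound i : R := (gi^-1 * a i)%R.

Lemma mass_bound_ge0 i : (0 <= mass_bound i)%R.
Proof.
apply: mulr_ge0; first by rewrite invr_ge0 ltW// ginf_gt0.
by apply: ltW; case: ha.
Qed.

Lemma esum_mass_bound : \esum_(i in setT) (mass_bound i)%:E < +oo.
Proof.
have [a0 sa] := ha.
have key (F : set I) : finite_set F -> \sum_(i \in F) (mass_bound i)%:E =
    (gi^-1)%:E * \sum_(i \in F) (a i)%:E.
  move=> fF; rewrite !fsbig_finite//= ge0_sume_distrr.
    by apply: eq_bigr => i _; rewrite -EFinM.
  by move=> i _; rewrite lee_fin ltW.
apply: (@le_lt_trans _ _ ((gi^-1)%:E * \esum_(i in setT) (a i)%:E)); last first.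
  by apply: lte_mul_pinfty => //; rewrite lee_fin invr_ge0 ltW// ginf_gt0.
apply: ge_ereal_sup => _ [F [fF _] <-]; rewrite key//; apply: lee_wpmul2l.
  by rewrite lee_fin invr_ge0 ltW// ginf_gt0.
by apply: ereal_sup_ubound; exists F.
Qed.

(** What feasible families share with [gam]: the mass bound [a_i / ginf] follows from the constraint
    and, unlike it, survives the vague limit. *)
Definition admissible mu := EplusA kappa alpha A mu /\ forall i, mu i setT <= (mass_bound i)%:E.

Definition ms mu i : mea R X := mrep (mu i).
Definition Rplusm mu : mea R X := msumI alpha (ms mu).
Definition Rminusm mu : mea R X := msumI (fun i => ~~ alpha i) (ms mu).

Section admissible_family.
Variable mu : I -> pmeas R X.
Hypothesis amu : admissible mu.

Lemma ms_eq i : meas_eq (ms mu i) (mu i).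
Proof. by apply: mrepE; case: amu => -[/(_ i)[]]. Qed.

Lemma ms_null i : ms mu i (~` A i) = 0.
Proof.
apply: concentrated_null; have [[/(_ i)[_ [B [mB B0 sB]]] _] _] := amu.
by exists B; split => //; rewrite ms_eq.
Qed.

Lemma ms_mass i : ms mu i setT <= (mass_bound i)%:E.
Proof. by rewrite ms_eq//; case: amu. Qed.

Lemma Rplus_eq : meas_eq (Rplus alpha mu) (Rplusm mu).
Proof. by move=> B mB; rewrite msumIE; apply: eq_esum => i _; rewrite ms_eq. Qed.

Lemma Rminus_eq : meas_eq (Rminus alpha mu) (Rminusm mu).
Proof. by move=> B mB; rewrite msumIE; apply: eq_esum => i _; rewrite ms_eq. Qed.

Lemma msumI_mass (Q : pred I) : msumI Q (ms mu) setT <= \esum_(i in setT) (mass_bound i)%:E.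
Proof.
rewrite msumIE esum_mkcond; apply: le_esum => i _; case: ifP => _.
  exact: ms_mass.
by rewrite lee_fin mass_bound_ge0.
Qed.

Lemma Rplusm_en : en (Rplusm mu).
Proof.
have [[_ [[rP eP] _ _]] _] := amu; split; last by rewrite -(eq_kmut _ Rplus_eq Rplus_eq).
apply: radon_finite_radon => //; first by apply: le_lt_trans (msumI_mass _) esum_mass_bound.
exact: radon_ext Rplus_eq rP.
Qed.

Lemma Rminusm_en : en (Rminusm mu).
Proof.
have [[_ [_ [rP eP] _]] _] := amu; split; last by rewrite -(eq_kmut _ Rminus_eq Rminus_eq).
apply: radon_finite_radon => //; first by apply: le_lt_trans (msumI_mass _) esum_mass_bound.
exact: radon_ext Rminus_eq rP.
Qed.

Lemma msumI_ge (Q : pred I) (ns : I -> mea R X) i B : Q i -> ns i B <= msumI Q ns B.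
Proof.
move=> Qi; rewrite msumIE; apply: esum_ge; exists [set i].
  by split=> // _ ->.
by rewrite fsbig_set1.
Qed.

Lemma ms_en i : en (ms mu i).
Proof.
have [ai|ai] := boolP (alpha i).
  by apply: (en_le hX hk _ Rplusm_en) => B mB; exact: msumI_ge.
by apply: (en_le hX hk _ Rminusm_en) => B mB; exact: (@msumI_ge (fun i => ~~ alpha i)).
Qed.

Lemma ms_energy_le i : (energy (ms mu i) (ms mu i) <= energy (Rplusm mu) (Rplusm mu) + energy (Rminusm mu) (Rminusm mu))%R.
Proof.
have [ai|ai] := boolP (alpha i).
  apply: (@le_trans _ _ (energy (Rplusm mu) (Rplusm mu))); last by rewrite lerDl energy_ge0.
  apply: (energy_le hX hk hka hke Rplusm_en Rplusm_en) => B mB; exact: msumI_ge.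
apply: (@le_trans _ _ (energy (Rminusm mu) (Rminusm mu))); last by rewrite lerDr energy_ge0.
apply: (energy_le hX hk hka hke Rminusm_en Rminusm_en) => B mB;
  exact: (@msumI_ge (fun i => ~~ alpha i)).
Qed.

Lemma msumI_null (Q : pred I) : msumI Q (ms mu) (~` \bigcup_(i in [set i | Q i]) A i) = 0.
Proof.
rewrite msumIE esum1// => i /= Qi.
have mU := bigA_borel Q.
apply: (subset_measure0 _ _ _ (ms_null i)).
- exact: measurableC.
- by apply: measurableC; exact: A_borel.
- by apply: subsetC => x Aix; exists i.
Qed.

End admissible_family.

Lemma cross_bound : exists C : R, forall mu, admissible mu -> (energy (Rplusm mu) (Rminusm mu) <= C)%R.
Proof.
have [_ _ _ [M HM]] := hA; pose S := fine (\esum_(i in setT) (mass_bound i)%:E).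
(* [S] bounds both total masses. The absolute value covers a negative [M], possible when A^+ or A^-
   is empty. *)
exists (`|M| * S * S)%R => mu amu.
have sb0 : 0 <= \esum_(i in setT) (mass_bound i)%:E.
  by apply: esum_ge0 => i _; rewrite lee_fin mass_bound_ge0.
have Sf : \esum_(i in setT) (mass_bound i)%:E = S%:E.
  by rewrite fineK// ge0_fin_numE// esum_mass_bound.
have S0 : (0 <= S)%R by rewrite fine_ge0.
have mP := bigA_borel alpha; have mN := bigA_borel (fun i => ~~ alpha i).
have pot x : Aplus alpha A x -> kpot kappa x (Rminusm mu) <= (`|M| * S)%:E.
  move=> Ax; rewrite /kpot (integral_setC_null _ mN (msumI_null amu (fun i => ~~ alpha i))).
  apply: (@le_trans _ _ (`|M|%:E * Rminusm mu (Aminus alpha A))).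
    rewrite -(integral_cst (Rminusm mu) mN); apply: ge0_le_integral => //.
    - by move=> y _; exact: kappa_ge0.
    - by apply: measurable_funTS; exact: kappa_measurable.
    - move=> y Ay; apply: (le_trans (HM _ _ Ax Ay)); rewrite lee_fin.
      exact: ler_norm.
  rewrite EFinM -Sf; apply: lee_wpmul2l; first by rewrite lee_fin.
  apply: le_trans (msumI_mass amu (fun i => ~~ alpha i)).
  by apply: le_measure; rewrite ?inE.
rewrite -lee_fin -(energyE hX hk hka hke (Rplusm_en amu) (Rminusm_en amu)) /kmut.
rewrite (integral_setC_null _ mP (msumI_null amu alpha)).
apply: (@le_trans _ _ ((`|M| * S)%:E * Rplusm mu (Aplus alpha A))).
  rewrite -(integral_cst (Rplusm mu) mP); apply: ge0_le_integral => //.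
  - by move=> y _; exact: kpot_ge0.
  - by apply: measurable_funTS; apply: kpot_measurable => //; exact: (Rminusm_en amu).1.
apply: (@le_trans _ _ ((`|M| * S)%:E * S%:E)).
  apply: lee_wpmul2l; first by rewrite lee_fin mulr_ge0.
  rewrite -Sf; apply: le_trans (msumI_mass amu alpha).
  by apply: le_measure; rewrite ?inE.
by rewrite -EFinM.
Qed.


Definition chipm : mea R X := mrep chip.
Definition chinm : mea R X := mrep chin.

Lemma chipm_eq : meas_eq chipm chip. Proof. by apply: mrepE; case: hchi => -[]. Qed.
Lemma chinm_eq : meas_eq chinm chin. Proof. by apply: mrepE; case: hchi => -[]. Qed.

Lemma chipm_en : en chipm.
Proof.
have [[rp rn _ [fp fn]] [[[_ ep] [_ en_] _] _ _]] := hchi.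
split; last by rewrite (eq_kmut _ chipm_eq chipm_eq).
by apply: radon_finite_radon => //; [rewrite chipm_eq|exact: radon_ext (meas_eq_sym chipm_eq) rp].
Qed.

Lemma chinm_en : en chinm.
Proof.
have [[rp rn _ [fp fn]] [[[_ ep] [_ en_] _] _ _]] := hchi.
split; last by rewrite (eq_kmut _ chinm_eq chinm_eq).
by apply: radon_finite_radon => //; [rewrite chinm_eq|exact: radon_ext (meas_eq_sym chinm_eq) rn].
Qed.

Lemma normA2E mu : admissible mu -> normA2 kappa alpha mu = (nrm2 (Rplusm mu) (Rminusm mu))%:E.
Proof.
move=> amu; have eP := Rplusm_en amu; have eN := Rminusm_en amu.
rewrite (nrm2_ip hX hk)// -(kbilE hX hk hka hke)//.
by apply: kbil_ext; [exact: Rplus_eq|exact: Rminus_eq|exact: Rplus_eq|exact: Rminus_eq].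
Qed.

Lemma GchiE mu : admissible mu -> Gchi kappa alpha chip chin mu =
  (nrm2 (Rplusm mu) (Rminusm mu) + 2 * ip chipm chinm (Rplusm mu) (Rminusm mu))%:E.
Proof.
move=> amu; have eP := Rplusm_en amu; have eN := Rminusm_en amu.
rewrite /Gchi normA2E//.
rewrite -[RHS]/((nrm2 (Rplusm mu) (Rminusm mu))%:E + 2%:E * (ip chipm chinm (Rplusm mu) (Rminusm mu))%:E).
rewrite -(kbilE hX hk hka hke chipm_en chinm_en eP eN).
congr (_ + _ * _); apply: kbil_ext; [exact: meas_eq_sym chipm_eq|
  exact: meas_eq_sym chinm_eq|exact: Rplus_eq|exact: Rminus_eq].
Qed.

Lemma Feasible_admissible mu : Feasible kappa alpha A g a mu -> admissible mu.
Proof.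
move=> [Emu gmu]; split => // i; have [rmu cmu] := Emu.1 i.
have e := mrepE rmu; rewrite -e//.
have m0 : (ms mu i) (~` A i) = 0.
  apply: concentrated_null; have [B [mB B0 sB]] := cmu.
  by exists B; split => //; rewrite -B0; exact: e.
rewrite /mass_bound EFinM; apply: (mass_le_ginf m0); rewrite -(mint_gA m0) -gmu.
by rewrite (mint_eq g (e : meas_eq (ms mu i) (mu i))).
Qed.

Lemma dist2_admissible mu mu' : admissible mu -> admissible mu' ->
  dist2 kappa (Rplus alpha mu) (Rminus alpha mu) (Rplus alpha mu') (Rminus alpha mu') =
  (nrm2 (mplus (Rplusm mu) (Rminusm mu')) (mplus (Rminusm mu) (Rplusm mu')))%:E.
Proof.
move=> amu amu'; have eP := Rplusm_en amu; have eN := Rminusm_en amu.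
have eP' := Rplusm_en amu'; have eN' := Rminusm_en amu'.
rewrite -(dist2E hX hk hka hke)// /dist2.
by apply: kbil_ext => B mB; rewrite /madd ?(Rplus_eq amu)// ?(Rminus_eq amu)//
  ?(Rplus_eq amu')// ?(Rminus_eq amu').
Qed.

(** Otherwise the restriction of [m] to [B], normalized to mass 1, would compete in the infimum with
    finite energy, and the inverse of a finite nonnegative infimum is not 0. *)
Lemma icap_null m (B : set (borelT X)) (N : set X) : en m -> measurable B -> B `<=` N ->
  icap kappa N = 0 -> m B = 0.
Proof.
move=> em mB BN iN; apply/eqP; apply: contrapT => /negP mB0.
have fB : m B \is a fin_num by apply: finite_measure_fin_num mB; case: em.1.
have r0 : (0 < fine (m B))%R.
  by rewrite fine_gt0// lt0e mB0 measure_ge0/= -ge0_fin_numE.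
have i0 : (0 <= (fine (m B))^-1)%R by rewrite invr_ge0 ltW.
pose nu := mmul (fine (m B))^-1 (mres m mB).
have enu : en nu.
  by apply: en_mul => //; apply: (en_le hX hk _ em) => E mE; exact: mres_le.
move: iN; rewrite /icap; set S := [set _ | _ in _].
have Snu : S (kmut kappa nu nu).
  exists nu => //=; split; first exact: en_finite_energy.
  split.
    exists (~` B); split; [exact: measurableC| |exact: subsetC].
    by rewrite mmulE// mresE setICl measure0 mule0.
  by rewrite mmulE// mresE setTI -{2}(fineK fB) -EFinM mulVf// gt_eqF.
have : ereal_inf S < +oo by apply: le_lt_trans (ereal_inf_lbound Snu) enu.2.
have : 0 <= ereal_inf S.
  apply: le_ereal_inf_tmp => _ [nu' [[rnu' _] _] <-].
  rewrite -(eq_kmut _ (mrepE rnu') (mrepE rnu')).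
  exact: (kmut_ge0 hk (mrep nu') (mrep nu')).
by case: inveP => // r r0' _ _ [] /eqP; rewrite invr_eq0 (negbTE r0').
Qed.

End condenser_measures.
(** The numerical core of the variation: the linear term is at most [-(3/2) t d], the quadratic one
    at most [t d / 2], and [G] exceeds [G0] by less than [t d / 4]. *)
Lemma variation_arith (R : realFieldType) (t d C x x0 y sgn n b b0 G0 G : R) :
  (0 < t -> 0 < d -> t * (2 * (C + 1)) <= d -> 0 <= C -> sgn = 1 \/ sgn = -1 ->
  n <= C -> `|x - x0| < d / 8 -> `|b - b0| < d / 8 -> `|G - G0| < t * d / 4 ->
  d = x0 - y ->
  G + 2 * t * (y - x + sgn * (b - b0)) + t ^+ 2 * n < G0)%R.
Proof.
move=> t0 d0 tC C0 sg1 nC; rewrite !ltr_norml => /andP[X1 X2] /andP[Y1 Y2] /andP[_ Z2] dE.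
have td : (0 < t * d)%R by rewrite mulr_gt0.
have sb : (sgn * (b - b0) < d / 8)%R by case: sg1 => ->; lra.
have L : (t * (y - x + sgn * (b - b0)) <= t * (- (3 / 4) * d))%R.
  by rewrite ler_pM2l//; lra.
have tn : (t ^+ 2 * n <= t * (d / 2))%R.
  rewrite expr2 -mulrA ler_pM2l//; apply: (@le_trans _ _ (t * C)%R).
    by rewrite ler_pM2l.
  by move: tC; lra.
by move: L tn td Z2; rewrite -!mulrA; lra.
Qed.

(** * Extremal measures *)

Section extremal_measure.
Context {R : realType} {X : ptopologicalType} {I : countType}.
Variables (kappa : X -> X -> \bar R) (h : R) (alpha : I -> bool) (A : I -> set X).
Variables (chip chin : pmeas R X) (g : X -> R) (a : I -> R).
Hypothesis hX : hausdorff_space X.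
Hypothesis lcX : locally_compact [set: X].
Hypothesis hk : kernel_basic kappa.
Hypothesis hka : strictly_pos_def kappa.
Hypothesis hkb : consistent kappa.
Hypothesis hke : gen_max_principle kappa h.
Hypothesis hA : condenser kappa alpha A.
Hypothesis hchi : external_field kappa alpha A chip chin.
Hypothesis hg : constraint_g kappa A g.
Hypothesis ha : constraint_a a.
Variables (gam : I -> pmeas R X).
Variables (D : Type) (le : D -> D -> Prop) (mus : D -> I -> pmeas R X).
Hypothesis Egam : EplusA kappa alpha A gam.
Hypothesis hmin : minimizing_net kappa alpha A chip chin g a h le mus.
Hypothesis hstr : forall e : R, (0 < e)%R -> exists s0, forall s, le s0 s ->
  dist2 kappa (Rplus alpha (mus s)) (Rminus alpha (mus s)) (Rplus alpha gam)
    (Rminus alpha gam) < e%:E.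
Hypothesis hvag : forall i, vague_conv le (fun s => mus s i) (gam i).
Implicit Types (m n p q : mea R X).
Local Notation en := (en kappa).
Local Notation energy := (energy kappa).
Local Notation ip := (ip kappa).
Local Notation nrm2 := (nrm2 kappa).
Local Notation admissible := (admissible kappa alpha A g a).
Local Notation Rplusm := (Rplusm alpha).
Local Notation Rminusm := (Rminusm alpha).
Local Notation chipm := (chipm chip).
Local Notation chinm := (chinm chin).
Local Notation gA := (gA A g).
Let enP m n := @en_plus R X kappa h hX hk hka hke m n.
Let enM t m := @en_mul R X kappa hX hk t m.
Let energyPl m n p := @energy_plusl R X kappa h hX hk hka hke m n p.
Let energyPr m n p := @energy_plusr R X kappa h hX hk hka hke m n p.
Let energyMl t m p := @energy_mull R X kappa h hX hk hka hke t m p.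
Let energyS m n := @energyC R X kappa hX hk m n.
Let ecp : en chipm := chipm_en hX hchi.
Let ecn : en chinm := chinm_en hX hchi.

Let dirD : directed le. Proof. by case: hmin. Qed.

Let feas s : Feasible kappa alpha A g a (mus s). Proof. by case: hmin. Qed.

Let adms s : admissible (mus s). Proof. exact: (Feasible_admissible hA hg (feas s)). Qed.

Let vag i : vague_conv le (fun s => ms (mus s) i) (ms gam i).
Proof.
move=> f cf e e0; have [s0 Hs] := @hvag i f cf e e0; exists s0 => s /Hs.
by rewrite -(mint_eq _ (ms_eq (adms s) i)) -(mint_eq _ (mrepE (Egam.1 i).1)).
Qed.

Lemma admissible_gam : admissible gam.
Proof.
split => // i; have rg := (Egam.1 i).1; rewrite -(mrepE rg)//.
apply: (vague_mass_le hX lcX dirD _ _ (vag i)).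
- by move=> s; exact: ms_mass.
- exact: radon_ext (meas_eq_sym (mrepE rg)) rg.
Qed.

Let eP s : en (Rplusm (mus s)) := Rplusm_en hX hg ha (adms s).
Let eN s : en (Rminusm (mus s)) := Rminusm_en hX hg ha (adms s).
Let eM s i : en (ms (mus s) i) := ms_en hX hk hg ha (adms s) i.
Local Notation P0 := (Rplusm gam).
Local Notation N0 := (Rminusm gam).
Let eP0 : en P0 := Rplusm_en hX hg ha admissible_gam.
Let eN0 : en N0 := Rminusm_en hX hg ha admissible_gam.
Let eM0 i : en (ms gam i) := ms_en hX hk hg ha admissible_gam i.

(** The difference [Tplus - Tminus] is [chi + R gam]. Every weighted potential is, up to sign, the
    potential of this one signed measure, and [Wval i m] below is its integral against [m]. *)
Definition Tplus := mplus chipm P0.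
Definition Tminus := mplus chinm N0.
Let epp : en Tplus := enP ecp eP0.
Let enn : en Tminus := enP ecn eN0.

Definition asign i : R := (if alpha i then 1 else -1)%R.
Definition Wval i m : R := (asign i * (energy m Tplus - energy m Tminus))%R.

Lemma WpotE i x : Wpot kappa alpha chip chin gam i x =
  (asign i)%:E * (kpot kappa x Tplus - kpot kappa x Tminus).
Proof.
rewrite /Wpot /kpot_s /asign; congr (_ * (_ - _)); first by case: (alpha i).
  apply: eq_kpot => B mB; rewrite /madd mplusE (chipm_eq hchi)//.
  by rewrite (Rplus_eq admissible_gam).
apply: eq_kpot => B mB; rewrite /madd mplusE (chinm_eq hchi)//.
by rewrite (Rminus_eq admissible_gam).
Qed.

Lemma kpot_integrable m q : en m -> en q ->
  m.-integrable setT (fun x => kpot kappa x q).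
Proof.
move=> em eq; apply/integrableP; split; first exact: kpot_measurable eq.1.
under eq_integral do rewrite gee0_abs ?kpot_ge0//.
exact: (kmut_lty hX hk hka hke em eq).
Qed.

Lemma Wpot_integrable i m : en m ->
  m.-integrable setT (Wpot kappa alpha chip chin gam i).
Proof.
move=> em; rewrite (funext (WpotE i)); apply: integrableZl => //.
by apply: integrableB => //; exact: kpot_integrable.
Qed.

Lemma Wpot_integral i m : en m ->
  \int[m]_x Wpot kappa alpha chip chin gam i x = (Wval i m)%:E.
Proof.
move=> em; under eq_integral do rewrite WpotE.
have ipp := kpot_integrable em epp; have inn := kpot_integrable em enn.
rewrite integralZl//; last exact: integrableB.
rewrite integralB// -![\int[_]_ _ _]/(kmut kappa _ _).
by rewrite -/(kmut kappa m Tplus) -/(kmut kappa m Tminus) !(energyE hX hk hka hke).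
Qed.

Lemma ip_diff s q1 q2 : en q1 -> en q2 ->
  ip (mplus (Rplusm (mus s)) N0) (mplus (Rminusm (mus s)) P0) q1 q2 =
  (ip (Rplusm (mus s)) (Rminusm (mus s)) q1 q2 - ip P0 N0 q1 q2)%R.
Proof.
move=> e1 e2; have := eP s; have := eN s => eNs ePs.
by rewrite /ip !energyPl//; gen_energy; lra.
Qed.

Lemma strong_conv (e : R) : (0 < e)%R -> exists s0, forall s, le s0 s ->
  (nrm2 (mplus (Rplusm (mus s)) N0) (mplus (Rminusm (mus s)) P0) < e)%R.
Proof.
move=> e0; have [s0 Hs] := hstr e0; exists s0 => s /Hs.
by rewrite (dist2_admissible hX hk hka hke hg ha (adms s) admissible_gam) lte_fin.
Qed.

(** Uniformity in [q1 - q2] matters: the variation pairs with [nu - mu_s^i], which moves with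
    [s]. *)
Lemma pairing_conv (C e : R) : (0 <= C)%R -> (0 < e)%R ->
  exists s0, forall s, le s0 s -> forall q1 q2, en q1 -> en q2 -> (nrm2 q1 q2 <= C)%R ->
  (`|ip (Rplusm (mus s)) (Rminusm (mus s)) q1 q2 - ip P0 N0 q1 q2| < e)%R.
Proof.
move=> C0 e0; have [d d0 Hd] := ip_small hX hk hka hke C0 e0.
have [s0 Hs] := strong_conv d0; exists s0 => s /Hs nd q1 q2 e1 e2 qC.
rewrite -ip_diff//; apply: Hd => //.
- exact: enP (eP s) eN0.
- exact: enP (eN s) eP0.
Qed.

(** * The functional and the components along the minimizing net *)

Definition Gval (mu : I -> pmeas R X) : R :=
  (nrm2 (Rplusm mu) (Rminusm mu) + 2 * ip chipm chinm (Rplusm mu) (Rminusm mu))%R.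

(** The exact expansion of a quadratic functional at [gam]: the linear term pairs [R mu_s - R gam]
    with [chi + R gam]. *)
Lemma Gval_diff s : Gval (mus s) = (Gval gam +
  nrm2 (mplus (Rplusm (mus s)) N0) (mplus (Rminusm (mus s)) P0) +
  2 * (ip (Rplusm (mus s)) (Rminusm (mus s)) Tplus Tminus - ip P0 N0 Tplus Tminus))%R.
Proof.
have := eP s; have := eN s; move=> eNs ePs.
have e1 := enP ePs eN0; have e2 := enP eNs eP0.
rewrite /Gval /nrm2 /ip /Tplus /Tminus !(energyPl, energyPr)//.
rewrite ?(energyS eP0 ePs) ?(energyS eN0 ePs) ?(energyS eP0 eNs) ?(energyS eN0 eNs) ?(energyS eN0 eP0).
rewrite ?(energyS eNs ePs) ?(energyS ePs ecp) ?(energyS ePs ecn) ?(energyS eNs ecp) ?(energyS eNs ecn).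
rewrite ?(energyS eP0 ecp) ?(energyS eP0 ecn) ?(energyS eN0 ecp) ?(energyS eN0 ecn).
by gen_energy; ring.
Qed.

Lemma Gval_conv (e : R) : (0 < e)%R -> exists s0, forall s, le s0 s ->
  (`|Gval (mus s) - Gval gam| < e)%R.
Proof.
move=> e0; have [_ _ letr leub] := dirD.
have e2 : (0 < e / 2)%R by rewrite divr_gt0.
have e4 : (0 < e / 4)%R by rewrite divr_gt0.
have [s1 H1] := strong_conv e2.
have [s2 H2] := pairing_conv (nrm2_ge0 hX hk hka hke epp enn) e4.
have [s3 [s13 s23]] := leub s1 s2; exists s3 => s s3s.
have := H1 s (letr _ _ _ s13 s3s).
have := H2 s (letr _ _ _ s23 s3s) _ _ epp enn (lexx _).
have := nrm2_ge0 hX hk hka hke (enP (eP s) eN0) (enP (eN s) eP0).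
rewrite Gval_diff !ltr_norml.
move: (nrm2 (mplus _ _) _) (ip (Rplusm (mus s)) _ _ _) (ip P0 _ _ _) (Gval gam) => x y z r.
by move=> ? /andP[? ?] ?; apply/andP; split; lra.
Qed.

Lemma GminE : Gmin kappa alpha A chip chin g a = (Gval gam)%:E.
Proof.
have [[s _] lexx' letr leub] := dirD; have [_ _ _ Hm] := hmin.
have GE s' := GchiE hX hk hka hke hchi hg ha (adms s').
have : Gmin kappa alpha A chip chin g a \is a fin_num.
  (* Being at distance less than 1 from a real number excludes an infinite [Gmin]. *)
  have [s0 /(_ _ (lexx' s0))] := Hm 1%R ltr01; rewrite GE.
  by case: (Gmin kappa alpha A chip chin g a).
move: Hm; case: (Gmin kappa alpha A chip chin g a) => [r||] // Hm _.
congr EFin; apply/eqP; rewrite -subr_eq0 -normr_le0; apply/ler_addgt0Pr => e e0.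
have e2 : (0 < e / 2)%R by rewrite divr_gt0.
have [s1 H1] := Hm _ e2; have [s2 H2] := Gval_conv e2.
have [s3 [s13 s23]] := leub s1 s2.
have := H1 s3 s13; have := H2 s3 s23.
rewrite GE -/(Gval _) -EFinB abse_EFin lte_fin !ltr_norml.
move: (Gval gam) (Gval (mus s3)) => x y /andP[? ?] /andP[? ?].
by rewrite add0r ler_norml; apply/andP; split; lra.
Qed.

Lemma component_energy_bound : exists2 C : R, (0 <= C)%R & exists s0, forall s, le s0 s ->
  forall i, (energy (ms (mus s) i) (ms (mus s) i) <= C)%R.
Proof.
have [_ _ letr leub] := dirD.
have [C1 HC1] := cross_bound hX hk hka hke hA hg ha.
have v0 := nrm2_ge0 hX hk hka hke eP0 eN0.
have [s1 H1] := strong_conv (@ltr01 R).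
have [s2 H2] := pairing_conv v0 (@ltr01 R).
have [s3 [s13 s23]] := leub s1 s2.
(* The 3 comes from [||R mu_s||^2 = ||R mu_s - R gam||^2 + 2 <R mu_s, R gam> - ||R gam||^2], where
   the first term is below 1 and the pairing below [||R gam||^2 + 1]; the cross energy adds the
   rest. *)
exists (nrm2 P0 N0 + 3 + 2 * `|C1|)%R; last exists s3 => s s3s i.
  by move: v0 (normr_ge0 C1); move: (nrm2 P0 N0) (`|C1|)%R => x y; lra.
apply: le_trans (ms_energy_le hX hk hka hke hg ha (adms s) i) _.
have := H1 s (letr _ _ _ s13 s3s).
have := H2 s (letr _ _ _ s23 s3s) _ _ eP0 eN0 (lexx _).
rewrite ltr_norml => /andP[_].
have cC : (energy (Rplusm (mus s)) (Rminusm (mus s)) <= `|C1|)%R.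
  by apply: le_trans (HC1 _ (adms s)) _; exact: ler_norm.
have ePs := eP s; have eNs := eN s.
have e1 := enP ePs eN0; have e2 := enP eNs eP0.
rewrite /nrm2 /ip !(energyPl, energyPr)//.
rewrite ?(energyS eP0 ePs) ?(energyS eN0 ePs) ?(energyS eP0 eNs) ?(energyS eN0 eNs) ?(energyS eN0 eP0).
rewrite ?(energyS eNs ePs); move: cC.
move: (`|C1|)%R => C2.
by gen_energy; lra.
Qed.

Lemma Wval_conv i (e : R) : (0 < e)%R -> exists s0, forall s, le s0 s ->
  (`|Wval i (ms (mus s) i) - Wval i (ms gam i)| < e)%R.
Proof.
move=> e0; have [C C0 [s1 HC]] := component_energy_bound.
have bnd : exists s0, forall s, le s0 s -> (energy (ms (mus s) i) (ms (mus s) i) <= C)%R.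
  by exists s1 => s s1s; exact: HC.
have [s0 Hs] := weak_conv hX hk hka hke hkb dirD (fun s => eM s i) (eM0 i) bnd
  (@vag i) epp enn e0.
exists s0 => s /Hs; rewrite /ip.
have eMs := eM s i; have eM0i := eM0 i.
rewrite (energyS epp eMs) (energyS enn eMs) (energyS epp eM0i) (energyS enn eM0i).
rewrite (_ : Wval i (ms (mus s) i) - Wval i (ms gam i) = asign i *
  (energy (ms (mus s) i) Tplus - energy (ms gam i) Tplus - energy (ms (mus s) i) Tminus
    + energy (ms gam i) Tminus))%R; last by rewrite /Wval; gen_energy; ring.
rewrite normrM (_ : `|asign i| = 1)%R ?mul1r//.
by rewrite /asign; case: ifP; rewrite ?normrN normr1.
Qed.

(** As [Gchi gam] is [||R gam||^2 + 2 <chi, R gam>], the average is [<R gam, chi + R gam>]. *)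
Lemma VE : (normA2 kappa alpha gam + Gmin kappa alpha A chip chin g a) * (2^-1)%:E =
  (ip P0 N0 Tplus Tminus)%:E.
Proof.
rewrite GminE (normA2E hX hk hka hke hg ha admissible_gam) -EFinD -EFinM; congr EFin.
rewrite /Gval /nrm2 /ip /Tplus /Tminus !energyPr//.
rewrite ?(energyS eN0 eP0) ?(energyS eP0 ecp) ?(energyS eP0 ecn) ?(energyS eN0 ecp) ?(energyS eN0 ecn).
by gen_energy; field.
Qed.

Lemma esum_energy (Q : pred I) q : en q -> en (msumI Q (ms gam)) ->
  \esum_(i in [set i | Q i]) (energy (ms gam i) q)%:E = (energy (msumI Q (ms gam)) q)%:E.
Proof.
move=> eq eQ; rewrite -(energyE hX hk hka hke)// /kmut integral_msumI; last 2 first.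
- exact: kpot_measurable eq.1.
- by move=> x; exact: kpot_ge0.
by apply: eq_esum => i _; rewrite -(energyE hX hk hka hke).
Qed.

Lemma esum_if (u v : I -> R) : (forall i, 0 <= u i)%R -> (forall i, 0 <= v i)%R ->
  \esum_(i in setT) (if alpha i then u i else v i)%:E =
  \esum_(i in [set i | alpha i]) (u i)%:E + \esum_(i in [set i | ~~ alpha i]) (v i)%:E.
Proof.
move=> u0 v0; rewrite (esumID [set i | alpha i]); last first.
  by move=> i _; rewrite lee_fin; case: ifP.
rewrite !setTI (_ : ~` [set i | alpha i] = [set i | ~~ alpha i]); last first.
  by apply/seteqP; split => i /=; [move/negP|move=> /negP].
by congr (_ + _); apply: eq_esum => i /=; [move=> ->|move=> /negbTE ->].
Qed.

Lemma esum_energyP q : en q ->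
  \esum_(i in [set i | alpha i]) (energy (ms gam i) q)%:E = (energy P0 q)%:E.
Proof. by move=> eq; exact: (@esum_energy alpha q eq eP0). Qed.

Lemma esum_energyN q : en q ->
  \esum_(i in [set i | ~~ alpha i]) (energy (ms gam i) q)%:E = (energy N0 q)%:E.
Proof. by move=> eq; exact: (@esum_energy (fun i => ~~ alpha i) q eq eN0). Qed.

Lemma csum_Wval : csum (fun i => (Wval i (ms gam i))%:E) = (ip P0 N0 Tplus Tminus)%:E.
Proof.
(* The sign of the plate decides which energy counts positively; both families are nonnegative, and
   their sums are energies of [P0] and [N0]. *)
pose u i := if alpha i then energy (ms gam i) Tplus else energy (ms gam i) Tminus.
pose v i := if alpha i then energy (ms gam i) Tminus else energy (ms gam i) Tplus.
have u0 i : (0 <= u i)%R by rewrite /u; case: ifP => _; exact: energy_ge0.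
have v0 i : (0 <= v i)%R by rewrite /v; case: ifP => _; exact: energy_ge0.
have su : \esum_(i in setT) (u i)%:E = (energy P0 Tplus + energy N0 Tminus)%:E.
  rewrite esum_if; [|by move=> i; exact: energy_ge0..].
  by rewrite (esum_energyP epp) (esum_energyN enn) EFinD.
have sv : \esum_(i in setT) (v i)%:E = (energy P0 Tminus + energy N0 Tplus)%:E.
  rewrite esum_if; [|by move=> i; exact: energy_ge0..].
  rewrite (esum_energyP enn) (esum_energyN epp) EFinD; exact: erefl.
have lu : \esum_(i in setT) (u i)%:E < +oo by rewrite su ltry.
have lv : \esum_(i in setT) (v i)%:E < +oo by rewrite sv ltry.
have -> : (fun i => (Wval i (ms gam i))%:E) = (fun i => (u i - v i)%:E).
  apply/funext => i; apply: (congr1 EFin); rewrite /Wval /u /v /asign.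
  by case: (alpha i); gen_energy; lra.
apply: (eq_trans (csum_sub u0 v0 lu lv)).
apply: (eq_trans (congr2 (fun b c => b - c) su sv)).
have -> : ip P0 N0 Tplus Tminus = ((energy P0 Tplus + energy N0 Tminus) - (energy P0 Tminus + energy N0 Tplus))%R.
  by rewrite /ip; gen_energy; lra.
exact: erefl.
Qed.

(** * Variation of one component *)

Lemma energy_eq m n q : meas_eq m n -> energy m q = energy n q.
Proof. by move=> e; rewrite /energy (eq_kmut _ e (nu' := q)). Qed.

Lemma msumI_upd_en (Q : pred I) (ns : I -> mea R X) i m : en (msumI Q ns) -> en m ->
  en (msumI Q (mupd ns i m)).
Proof.
move=> eQ em; apply: (en_le hX hk _ (enP eQ em)) => B mB; rewrite mplusE.
apply: (@le_trans _ _ (msumI Q ns B + (if Q i then m B else 0))).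
  by rewrite -msumI_upd leeDl//; case: ifP.
by rewrite leeD2l//; case: ifP.
Qed.

Lemma energy_upd (Q : pred I) (ns : I -> mea R X) i m q : en (msumI Q ns) -> en m -> en q ->
  en (ns i) ->
  energy (msumI Q (mupd ns i m)) q =
  (energy (msumI Q ns) q + (if Q i then energy m q - energy (ns i) q else 0))%R.
Proof.
move=> eQ em eq ei; have eQ' := msumI_upd_en i eQ em.
case: ifPn => Qi; last first.
  rewrite addr0; apply: energy_eq => B mB.
  by have := msumI_upd Q ns i m B; rewrite (negbTE Qi) !adde0.
(* Adding the removed component back avoids a difference of measures. *)
have : energy (mplus (msumI Q (mupd ns i m)) (ns i)) q = energy (mplus (msumI Q ns) m) q.
  by apply: energy_eq => B mB; have := msumI_upd Q ns i m B; rewrite Qi !mplusE.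
rewrite (energyPl eQ' ei eq) (energyPl eQ em eq) addrA => <-.
by rewrite addrK.
Qed.

Section variation.
Variables (i : I) (nu : mea R X) (s : D) (t : R).
Hypothesis enu : en nu.
Hypothesis nu0 : nu (~` A i) = 0.
Hypothesis nug : \int[nu]_x gA i x = (a i)%:E.
Hypothesis t01 : (0 <= t <= 1)%R.
Let x := ms (mus s) i.
Let y := mplus (mmul (1 - t) x) (mmul t nu).
Let M := mupd (ms (mus s)) i y.
Let t0 : (0 <= t)%R. Proof. by case/andP: t01. Qed.
Let t1 : (0 <= 1 - t)%R. Proof. by rewrite subr_ge0; case/andP: t01. Qed.
Let ex : en x := eM s i.
Let ey : en y := enP (enM t1 ex) (enM t0 enu).
Let P := msumI alpha M.
Let N := msumI (fun i => ~~ alpha i) M.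
Let ePM : en P := msumI_upd_en i (eP s) ey.
Let eNM : en N := @msumI_upd_en (fun i => ~~ alpha i) _ i y (eN s) ey.

Lemma variation_feasible : Feasible kappa alpha A g a M.
Proof.
have y0 : y (~` A i) = 0.
  have x0 : x (~` A i) = 0 := ms_null hA (adms s) i.
  by rewrite mplusE (mmulE _ _ t1) (mmulE _ _ t0) nu0 x0 !mule0 adde0.
have MP j : en (M j) by rewrite /M /mupd; case: ifP.
have M0 j : M j (~` A j) = 0.
  rewrite /M /mupd; case: eqVneq => [->|_] //.
  exact: (ms_null hA (adms s) j).
split; last first.
  move=> j; rewrite (mint_gA g hA (M0 j)).
  have gs k : \int[ms (mus s) k]_z gA k z = (a k)%:E.
    rewrite -(mint_gA g hA (ms_null hA (adms s) k)) -(feas s).2.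
    exact: mint_eq (ms_eq (adms s) k).
  rewrite /M /mupd; case: eqVneq => [->|_] //.
  have mg := gA_measurable hA hg i; have g0 := gA_ge0 hg i.
  rewrite /y integral_mplus// !integral_mmul// gs nug -!EFinM -EFinD.
  by apply: (congr1 EFin); ring.
split; first move=> j.
  split; first by apply: finite_radon_radon => //; exact: (MP j).1.
  exact: null_concentrated (A_borel hA j) (M0 j).
have RP : Rplus alpha (fun j => M j : pmeas R X) = P.
  by apply/funext => B; rewrite /P msumIE.
have RN : Rminus alpha (fun j => M j : pmeas R X) = N.
  by apply/funext => B; rewrite /N msumIE.
rewrite RP RN; split; [exact: en_finite_energy|exact: en_finite_energy|].
exact: (kmut_lty hX hk hka hke ePM eNM).
Qed.

Lemma variation_Gchi : Gchi kappa alpha chip chin M =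
  (nrm2 P N + 2 * ip chipm chinm P N)%:E.
Proof.
have RP : Rplus alpha (fun j => M j : pmeas R X) = P.
  by apply/funext => B; rewrite /P msumIE.
have RN : Rminus alpha (fun j => M j : pmeas R X) = N.
  by apply/funext => B; rewrite /N msumIE.
rewrite /Gchi /normA2 RP RN (kbilE hX hk hka hke ePM eNM ePM eNM).
rewrite -(nrm2_ip hX hk ePM eNM).
rewrite (_ : kbil kappa chip chin P N = kbil kappa chipm chinm P N); last first.
  by apply: kbil_ext => // B mB; rewrite ?(chipm_eq hchi) ?(chinm_eq hchi).
by rewrite (kbilE hX hk hka hke ecp ecn ePM eNM).
Qed.

(** The minimum is compared with [Gchi M], a quadratic polynomial in [t]. Its linear coefficient
    pairs [nu - x] with [chi + R mu_s]; replacing this by [chi + R gam] gives the [Wval] terms and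
    leaves a correction that [pairing_conv] makes small. *)
Lemma variation_ineq : (Gval gam <= Gval (mus s) + 2 * t *
  (Wval i nu - Wval i x + asign i * (ip (Rplusm (mus s)) (Rminusm (mus s)) nu x - ip P0 N0 nu x))
  + t ^+ 2 * nrm2 nu x)%R.
Proof.
have : Gmin kappa alpha A chip chin g a <= Gchi kappa alpha chip chin M.
  by apply: ereal_inf_lbound; exists M => //; exact: variation_feasible.
rewrite GminE variation_Gchi lee_fin => L; apply: (le_trans L).
rewrite le_eqVlt; apply/orP; left; apply/eqP.
have ePs := eP s; have eNs := eN s.
have kP q : en q -> energy P q = (energy (Rplusm (mus s)) q +
    (if alpha i then t * (energy nu q - energy x q) else 0))%R.
  move=> eq; rewrite /P (energy_upd ePs ey eq (eM s i)); congr (_ + _)%R.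
  case: ifP => // _; rewrite (energyPl (enM t1 ex) (enM t0 enu) eq).
  rewrite (energyMl t1 ex eq) (energyMl t0 enu eq) -/x.
  by gen_energy; ring.
have kN q : en q -> energy N q = (energy (Rminusm (mus s)) q +
    (if alpha i then 0 else t * (energy nu q - energy x q)))%R.
  move=> eq; rewrite /N (@energy_upd (fun i => ~~ alpha i) _ i y q eNs ey eq (eM s i)).
  congr (_ + _)%R; rewrite if_neg; case: ifP => // _.
  rewrite (energyPl (enM t1 ex) (enM t0 enu) eq).
  rewrite (energyMl t1 ex eq) (energyMl t0 enu eq) -/x.
  by gen_energy; ring.
have kC q : en q -> energy q P = energy P q by move=> eq; exact: energyS.
have kCN q : en q -> energy q N = energy N q by move=> eq; exact: energyS.
rewrite /Gval /Wval /asign /nrm2 /ip /Tplus /Tminus.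
rewrite (energyPr ecp eP0 enu) (energyPr ecn eN0 enu) (energyPr ecp eP0 ex) (energyPr ecn eN0 ex).
rewrite (kC _ ecp) (kC _ ecn) (kCN _ ecp) (kCN _ ecn).
rewrite !(kP _ ePM) !(kP _ eNM) !(kN _ eNM) !(kP _ ecp) !(kP _ ecn) !(kN _ ecp) !(kN _ ecn).
rewrite !(kC _ ePs) !(kC _ enu) !(kC _ ex) !(kCN _ ePs) !(kCN _ eNs) !(kCN _ enu) !(kCN _ ex).
rewrite !(kP _ ePs) !(kP _ enu) !(kP _ ex) !(kN _ ePs) !(kN _ eNs) !(kN _ enu) !(kN _ ex).
rewrite ?(energyS enu ePs) ?(energyS enu eNs) ?(energyS ex ePs) ?(energyS ex eNs) ?(energyS ex enu).
rewrite ?(energyS enu ecp) ?(energyS enu ecn) ?(energyS ex ecp) ?(energyS ex ecn) ?(energyS eNs ePs).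
rewrite ?(energyS enu eP0) ?(energyS enu eN0) ?(energyS ex eP0) ?(energyS ex eN0).
rewrite ?(energyS ePs ecp) ?(energyS eNs ecp) ?(energyS ePs ecn) ?(energyS eNs ecn).
by case: (alpha i); gen_energy; ring.
Qed.

End variation.

Lemma variation_limit i nu : en nu -> nu (~` A i) = 0 ->
  \int[nu]_x gA i x = (a i)%:E -> (Wval i (ms gam i) <= Wval i nu)%R.
Proof.
move=> enu nu0 nug; rewrite leNgt; apply/negP => lt.
have [_ _ letr leub] := dirD.
pose d := (Wval i (ms gam i) - Wval i nu)%R.
have d0 : (0 < d)%R by rewrite subr_gt0.
have [C C0 [s1 HC]] := component_energy_bound.
(* Mutual energies are nonnegative, so [C'] bounds [||nu - mu_s^i||^2] for all late [s]. *)
pose C' := (energy nu nu + C)%R.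
have C'0 : (0 <= C')%R by rewrite addr_ge0// energy_ge0.
(* A fixed small [t] stands for the passage to 0: it depends only on [d] and [C'], is chosen before
   [s], and keeps the quadratic term below [t * d / 2]. *)
pose t := Num.min 1%R (d / (2 * (C' + 1)))%R.
have den : (0 < 2 * (C' + 1))%R by rewrite mulr_gt0// ltr_wpDl.
have t0 : (0 < t)%R by rewrite lt_min ltr01 divr_gt0.
have t01 : (0 <= t <= 1)%R by rewrite ltW//= ge_min lexx.
have tC : (t * (2 * (C' + 1)) <= d)%R.
  by rewrite -ler_pdivlMr// ge_min lexx orbT.
have d8 : (0 < d / 8)%R by rewrite divr_gt0.
have td : (0 < t * d / 4)%R by rewrite divr_gt0// mulr_gt0.
have [s2 H2] := Gval_conv td.
have [s3 H3] := pairing_conv C'0 d8.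
have [s4 H4] := Wval_conv i d8.
have [u1 [u1a u1b]] := leub s1 s2; have [u2 [u2a u2b]] := leub s3 s4.
have [s [su1 su2]] := leub u1 u2.
have ex := eM s i.
have nC : (nrm2 nu (ms (mus s) i) <= C')%R.
  have := HC s (letr _ _ _ u1a su1) i; have := energy_ge0 hk nu (ms (mus s) i).
  by rewrite /nrm2 /C'; gen_energy; lra.
have sg1 : (asign i = 1 \/ asign i = -1)%R by rewrite /asign; case: (alpha i); [left|right].
have := variation_arith t0 d0 tC C'0 sg1 nC (H4 s (letr _ _ _ u2b su2))
  (H3 s (letr _ _ _ u2a su2) _ _ enu ex nC) (H2 s (letr _ _ _ u1b su1)) erefl.
by rewrite ltNge (variation_ineq s enu nu0 nug t01).
Qed.

(** * The exceptional sets and uniqueness *)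

Local Notation W i := (Wpot kappa alpha chip chin gam i).

Definition gap i (c : R) x : \bar R := c%:E * gA i x - (a i)%:E * W i x.

Lemma W_measurable i : measurable_fun [set: borelT X] (W i).
Proof. by have /measurable_int := Wpot_integrable i ecp. Qed.

Lemma gap_measurable i c : measurable_fun [set: borelT X] (gap i c).
Proof.
apply: emeasurable_funB; apply: measurable_funeM.
  exact: gA_measurable hA hg i.
exact: W_measurable.
Qed.

Lemma gap_integral i c m (r : R) : en m -> \int[m]_x gA i x = r%:E ->
  \int[m]_x gap i c x = (c * r - a i * Wval i m)%:E.
Proof.
move=> em mr.
have ig : m.-integrable setT (gA i).
  apply/integrableP; split; first exact: gA_measurable hA hg i.
  under eq_integral do rewrite gee0_abs ?(gA_ge0 hg)//.
  by rewrite mr ltry.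
have iW := Wpot_integrable i em.
rewrite /gap integralB//; [|exact: integrableZl|exact: integrableZl].
by rewrite !integralZl// mr Wpot_integral// -!EFinM -EFinB.
Qed.

(** Capacity zero holds in the strongest form: no unit measure of finite energy is concentrated on
    the set, and the infimum over the empty family is [+oo]. *)
Lemma ne_lower i : icap kappa [set x | A i x /\
  ~ ((Wval i (ms gam i))%:E * (g x)%:E <= (a i)%:E * W i x)] = 0.
Proof.
set Bad := [set x | _]; set c := Wval i (ms gam i).
rewrite /icap; set S := [set _ | _ in _].
suff -> : S = set0 by rewrite ereal_inf0 invey.
apply/seteqP; split => // z [nu0 [[rnu enu] [cnu nu1]] _].
pose m0 : mea R X := mrep nu0.
have m0E : meas_eq m0 nu0 := mrepE rnu.
have m0T : m0 setT = 1 by rewrite m0E.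
have em0 : en m0.
  split; last by rewrite (eq_kmut _ m0E m0E).
  apply: radon_finite_radon => //; first by rewrite m0T ltry.
  exact: radon_ext (meas_eq_sym m0E) rnu.
have fm0 : m0 setT < +oo by rewrite m0T ltry.
(* The bound on [g] makes its integral finite, so that the restricted measure can be rescaled to
   meet the constraint; the bound on the gap makes the integral of the gap strictly positive. *)
pose B (k : nat) : set (borelT X) := A i `&` [set x | gA i x <= k%:R%:E] `&`
  [set x | (k.+1%:R^-1)%:E <= gap i c x].
have mA := A_borel hA i.
have mB k : measurable (B k).
  apply: measurableI; first apply: measurableI => //.
    have := emeasurable_fun_infty_c measurableT (gA_measurable hA hg i) k%:R%:E.
    by rewrite setTI.
  have := emeasurable_fun_c_infty measurableT (gap_measurable i c) (k.+1%:R^-1)%:E.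
  by rewrite setTI.
have BadB : Bad `<=` \bigcup_k B k.
  move=> x [Ax /negP]; rewrite -ltNge -sube_gt0 -(gA_in g Ax) -/(gap i c x) => gx.
  have gk k : (Num.truncn (g x) < k)%N -> gA i x <= k%:R%:E.
    move=> xk; rewrite (gA_in g Ax) lee_fin; apply: ltW.
    by apply: lt_le_trans (truncnS_gt _) _; rewrite ler_nat.
  move: gx; case E : (gap i c x) => [r||] //; last first.
    move=> _; exists (Num.truncn (g x)).+1 => //.
    by split; [split => //; exact: gk|rewrite /= E leey].
  rewrite lte_fin => r0.
  exists (maxn (Num.truncn (g x)).+1 (Num.truncn r^-1).+1) => //.
  split; first by split => //; apply: gk; exact: leq_maxl.
  rewrite /= E lee_fin invf_ple ?posrE//; apply: ltW.
  apply: lt_le_trans (truncnS_gt _) _; rewrite ler_nat.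
  by apply: leqW; exact: leq_maxr.
have [k Bk] : exists k, 0 < m0 (B k).
  apply: contrapT => nk.
  have B0 k : m0 (B k) = 0.
    apply/eqP; apply: contrapT => /negP mk; apply: nk; exists k.
    by rewrite lt0e mk measure_ge0.
  have [N [mN N0 sN]] : m0.-negligible (\bigcup_k B k).
    by apply: negligible_bigcup => k; exists (B k); split.
  have [N' [mN' N0' sN']] := cnu.
  have : m0 setT = 0.
    apply: (@subset_measure0 _ _ _ m0 _ (N `|` N')) => //.
    - exact: measurableU.
    - move=> x _; have [/BadB Bx|nBx] := pselect (Bad x); [left; exact: sN|right].
      exact: sN'.
    - by apply: null_set_setU => //; rewrite m0E.
  by rewrite m0T => /eqP; rewrite onee_eq0.
pose m1 := mres m0 (mB k).
have em1 : en m1 by apply: (en_le hX hk _ em0) => E mE; exact: mres_le.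
have m1B : m1 (~` B k) = 0 by rewrite mresE setICl measure0.
have BA : B k `<=` A i by move=> x [[]].
have m1A : m1 (~` A i) = 0.
  apply: (subset_measure0 _ _ _ m1B); [exact: measurableC|exact: measurableC|].
  exact: subsetC.
have m1T : 0 < m1 setT by rewrite mresE setTI.
have g1 : \int[m1]_x gA i x < +oo.
  rewrite integral_mres; apply: (@le_lt_trans _ _ (k%:R%:E * m0 (B k))).
    rewrite -(integral_cst m0 (mB k)); apply: ge0_le_integral => //.
    - by move=> x _; exact: gA_ge0 hg i x.
    - by apply: measurable_funTS; exact: gA_measurable hA hg i.
    - by move=> x [[]].
  by rewrite lte_mul_pinfty// ?lee_fin//; exact: finite_measure_lty.
have g0 : 0 < \int[m1]_x gA i x.
  rewrite lt0e integral_ge0 ?andbT; last by move=> x _; exact: gA_ge0 hg i x.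
  apply/eqP => I0; have := mass_le_ginf hA hg m1A (lexx _).
  by rewrite I0 mule0 leNgt m1T.
move: g0 g1; case E1 : (\int[m1]_x gA i x) => [I1||] // I10 _.
rewrite lte_fin in I10.
have a0 : (0 < a i)%R by case: ha.
have r0 : (0 < a i / I1)%R by rewrite divr_gt0.
pose nu := mmul (a i / I1) m1.
have enu' : en nu := enM (ltW r0) em1.
have nuA : nu (~` A i) = 0 by rewrite mmulE ?ltW// m1A mule0.
have nuB : nu (~` B k) = 0 by rewrite mmulE ?ltW// m1B mule0.
have nug : \int[nu]_x gA i x = (a i)%:E.
  rewrite integral_mmul ?ltW//; [|exact: gA_measurable hA hg i|exact: gA_ge0 hg i].
  by rewrite E1 -EFinM divfK// gt_eqF.
have cw := variation_limit enu' nuA nug.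
have gle : \int[nu]_x gap i c x <= 0.
  by rewrite (gap_integral c enu' nug) lee_fin mulrC -mulrBr pmulr_rle0// subr_le0.
have : 0 < \int[nu]_x gap i c x.
  rewrite (integral_setC_null _ (mB k) nuB).
  apply: (@lt_le_trans _ _ ((k.+1%:R^-1)%:E * nu (B k))).
    rewrite mule_gt0 ?lte_fin ?invr_gt0// mmulE ?ltW// mule_gt0 ?lte_fin//.
    by rewrite mresE setIid.
  rewrite -(integral_cst nu (mB k)); apply: ge0_le_integral => //.
  - by move=> x _; rewrite lee_fin.
  - by apply: measurable_funTS; exact: gap_measurable.
  - by move=> x [_].
by rewrite ltNge gle.
Qed.

Lemma eta_le i (eta : R) : nearly_everywhere kappa
    (fun x => (eta * g x)%:E <= (a i)%:E * W i x) (A i) ->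
  (eta <= Wval i (ms gam i))%R.
Proof.
move=> [N [N0 HN]].
have a0 : (0 < a i)%R by case: ha.
have mA := A_borel hA i.
have step s : (eta <= Wval i (ms (mus s) i))%R.
  have es := eM s i.
  have gs : \int[ms (mus s) i]_z gA i z = (a i)%:E.
    rewrite -(mint_gA g hA (ms_null hA (adms s) i)) -(feas s).2.
    exact: mint_eq (ms_eq (adms s) i).
  (* The set [N] need not be Borel; the set [F] where the inequality fails is Borel and lies in [N],
     so measures of finite energy do not charge it. *)
  pose F : set (borelT X) := A i `&` [set x | 0 < gap i eta x].
  have mF : measurable F.
    apply: measurableI => //.
    have := emeasurable_fun_o_infty measurableT (gap_measurable i eta) 0.
    by rewrite setTI.
  have FN : F `<=` N.
    move=> x [Ax /=]; rewrite /gap (gA_in g Ax) -EFinM sube_gt0 ltNge => /negP Fx.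
    by apply: contrapT => nNx; apply: Fx; exact: HN.
  have F0 : ms (mus s) i F = 0 := icap_null hX hk es mF FN N0.
  have nE : ms (mus s) i (~` (A i `\` F)) = 0.
    rewrite setCD; apply: null_set_setU => //; first exact: measurableC.
    exact: (ms_null hA (adms s) i).
  have : \int[ms (mus s) i]_x gap i eta x <= 0.
    rewrite (integral_setC_null _ (measurableD mA mF) nE).
    rewrite integralE integral0_eq; last first.
      move=> x [Ax nF]; rewrite funeposE; apply/max_idPr; rewrite leNgt.
      by apply/negP => gx; apply: nF.
    by rewrite sub0e oppe_le0; apply: integral_ge0 => x _; exact: funeneg_ge0.
  by rewrite (gap_integral eta es gs) lee_fin mulrC -mulrBr pmulr_rle0// subr_le0.
apply/ler_addgt0Pr => e e0; have [s0 Hs] := Wval_conv i e0.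
have [_ lexx' _ _] := dirD.
have := Hs s0 (lexx' s0); rewrite ltr_norml => /andP[_].
have := step s0; move: (Wval i _) (Wval i _) => x y.
by lra.
Qed.

Lemma gam_integralE i : \int[gam i]_x W i x = (Wval i (ms gam i))%:E.
Proof.
rewrite -Wpot_integral//; apply: eq_pmeas_integral.
exact: meas_eq_sym (ms_eq admissible_gam i).
Qed.

Lemma extremal_characterization :
  let c := fun i => \int[gam i]_x W i x in
  let V := (normA2 kappa alpha gam + Gmin kappa alpha A chip chin g a) * (2^-1)%:E in
  [/\ csum c = V,
      (forall i, nearly_everywhere kappa
         (fun x => c i * (g x)%:E <= (a i)%:E * W i x) (A i)) &
      (forall eta : I -> R, csum (fun i => (eta i)%:E) = V ->
         (forall i, nearly_everywhere kappa
            (fun x => (eta i * g x)%:E <= (a i)%:E * W i x) (A i)) ->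
         forall i, (eta i)%:E = c i)].
Proof.
move=> c V; have cE : c = (fun i => (Wval i (ms gam i))%:E).
  by apply/funext => i; exact: gam_integralE.
rewrite cE /V VE; split.
- exact: csum_Wval.
- move=> i; eexists; split; first exact: (ne_lower i).
  by move=> x Ax nx; apply: contrapT => nle; apply: nx.
- move=> eta seta neta i; apply: (congr1 EFin).
  apply: (csum_eq_le seta csum_Wval) => j.
  exact: eta_le (neta j).
Qed.

End extremal_measure.
Theorem theorem12p1 (R : realType) (X : ptopologicalType) (I : countType)
  (kappa : X -> X -> \bar R) (h : R)
  (alpha : I -> bool) (A : I -> set X)
  (chip chin : pmeas R X) (g : X -> R) (a : I -> R)
  (hX : hausdorff_space X) (lcX : locally_compact [set: X])
  (ncX : ~ compact [set: X])
  (hk : kernel_basic kappa)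
  (hka : strictly_pos_def kappa)
  (hkb : consistent kappa)
  (hkc : kernel_finite_cont_offdiag kappa)
  (hkd : kernel_vanish_infty kappa)
  (hke : gen_max_principle kappa h)
  (hA : condenser kappa alpha A)
  (hchi : external_field kappa alpha A chip chin)
  (hg : constraint_g kappa A g)
  (ha : constraint_a a)
  (hfin : Gmin kappa alpha A chip chin g a < +oo)
  (gam : I -> pmeas R X)
  (hgam : extremal kappa alpha A chip chin g a h gam) :
  let c := fun i => \int[gam i]_x Wpot kappa alpha chip chin gam i x in
  let V := (normA2 kappa alpha gam + Gmin kappa alpha A chip chin g a)
             * (2^-1)%:E in
  [/\ csum c = V,
      (forall i, nearly_everywhere kappa
         (fun x => c i * (g x)%:E <= (a i)%:E * Wpot kappa alpha chip chin gam i x)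
         (A i)) &
      (forall eta : I -> R,
         csum (fun i => (eta i)%:E) = V ->
         (forall i, nearly_everywhere kappa
            (fun x => (eta i * g x)%:E <= (a i)%:E * Wpot kappa alpha chip chin gam i x)
            (A i)) ->
         forall i, (eta i)%:E = c i)].

Proof.
have [Egam [D [le [mus [hmin hstr hvag]]]]] := hgam.
exact: (extremal_characterization hX lcX hk hka hkb hke hA hchi hg ha Egam hmin hstr hvag).
Qed.
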